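(* There exist universal positive constants $\bar A\le4$ and $\bar B\ge 2/\pi^2$ such that for every $H\in[1/2,1)$, every $S>0$, every $c\in(0,S^H]$ and every $u>0$, $$\mathbf P\left(\left|\mathrm{TV}^c(W^H,S)-\mathbf E\,\mathrm{TV}^c(W^H,S)\right|>u\right)\le \bar A\exp\left(-\bar B\,S^{-2H}u^2\right),$$ or, equivalently (writing $u=Sc^{1-\frac1H}v$), for every $v>0$, $$\mathbf P\left(\left|\mathrm{TV}^c(W^H,S)-\mathbf E\,\mathrm{TV}^c(W^H,S)\right|>Sc^{1-\frac1H}v\right)\le \bar A\exp\left(-\bar B\left(Sc^{-\frac1H}\right)^{2-2H}v^2\right).$$
   Context: $W^H=(W^H_t)_{t\ge0}$ is a fractional Brownian motion with Hurst index $H\in(0,1)$, i.e. a centered Gaussian process with (a.s.) continuous trajectories and $\mathbf E(W^H_sW^H_t)=\frac12\{|s|^{2H}+|t|^{2H}-|t-s|^{2H}\}$ for $s,t\ge0$. For a path $f:[0,+\infty)\to\mathbb R$ that is right-continuous with left limits, $c\ge0$ and $0\le s<t$, the truncated variation is $$\mathrm{TV}^c(f,[s,t])=\sup_{n\ge1}\ \sup_{s\le s_1<t_1\le s_2<t_2\le\dots\le s_n<t_n\le t}\ \sum_{i=1}^n\left(|f(t_i)-f(s_i)|-c\right)_+,\qquad (x)_+=\max(x,0),$$ and $\mathrm{TV}^c(f,S):=\mathrm{TV}^c(f,[0,S])$ for $S>0$. *)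

(* Defs.v *)
From mathcomp Require Import all_boot all_order all_algebra.
From mathcomp Require Import all_classical all_reals all_analysis.

Set Implicit Arguments.
Unset Strict Implicit.
Unset Printing Implicit Defensive.

Import Order.TTheory GRing.Theory Num.Theory.
Import numFieldNormedType.Exports.

Local Open Scope classical_set_scope.
Local Open Scope ring_scope.

(* [s] is the standard deviation. The library's [normal_prob m 0] is an
   arbitrary convention (the uniform law on [0, 1]); a Gaussian law with
   variance 0 has to be a point mass. *)
Definition gaussian_law (R : realType) (m s : R) (A : set R) : \bar R :=
  if s == 0 then \d_m A else normal_prob m s A.

Definition gaussian (R : realType) (d : measure_display)
    (T : measurableType d) (P : probability T R) (X : T -> R) : Prop :=
  exists m s : R, 0 <= s /\
    forall A : set R, measurable A -> pushforward P X A = gaussian_law m s A.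

(* The time set is [0, +oo[: the values of [W] at negative times are junk that
   no definition below constrains or uses. *)
Definition gaussian_process (R : realType) (d : measure_display)
    (T : measurableType d) (P : probability T R) (W : R -> {RV P >-> R}) :
    Prop :=
  forall (n : nat) (t a : 'I_n -> R), (forall i, 0 <= t i) ->
    gaussian P (fun w => \sum_(i < n) a i * W (t i) w).

Definition fractional_brownian_motion (R : realType) (d : measure_display)
    (T : measurableType d) (P : probability T R) (H : R)
    (W : R -> {RV P >-> R}) : Prop :=
  [/\ 0 < H < 1,
      gaussian_process W,
      forall t : R, 0 <= t -> ('E_P[W t] = 0)%E,
      forall s t : R, 0 <= s -> 0 <= t ->
        ('E_P[fun w => (W s w * W t w)%R] =
          (2^-1 * (`|s| `^ (2 * H) + `|t| `^ (2 * H)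
                   - `|t - s| `^ (2 * H)))%:E)%E
    & {ae P, forall w, {within `[0, +oo[, continuous (fun t : R => W t w : R)}}].

(* [a i] and [b i], i < n, are the usual s_(i+1) and t_(i+1); their values at
   indices i >= n are irrelevant. *)
Definition truncated_variation (R : realType) (c : R) (f : R -> R) (s t : R) :
    \bar R :=
  ereal_sup [set x : \bar R | exists (n : nat) (a b : nat -> R),
    [/\ (0 < n)%N,
        s <= a 0%N,
        forall i, (i < n)%N -> a i < b i,
        forall i, (i.+1 < n)%N -> b i <= a i.+1
      & b n.-1 <= t] /\
    x = (\sum_(i < n) Num.max (`|f (b i) - f (a i)| - c) 0)%:E].

Definition TV (R : realType) (c : R) (f : R -> R) (S : R) : \bar R :=
  truncated_variation c f 0 S.

(* The outer measure of [P], i.e. the completion of [P] on the completed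
   sigma-algebra and [P] itself on measurable sets. It is needed because
   trajectories are only almost surely continuous and the probability space need
   not be complete, so that events about whole trajectories are in general
   measurable only up to a null set. *)
Definition completed_prob (R : realType) (d : measure_display)
    (T : measurableType d) (P : probability T R) (E : set T) : \bar R :=
  mu_ext P E.

Arguments gaussian_process {R d T} P W.
Arguments fractional_brownian_motion {R d T} P H W.

(* Main.v *)
(* For a continuous path f, TV^c(f, S) is the supremum, over the countably many
   ordered families of disjoint intervals with rational endpoints in [0, S] and
   signs, of the affine functionals sum_i (eps_i (f(b_i) - f(a_i)) - c). For
   H >= 1/2 the increments of W^H over disjoint intervals are nonnegatively
   correlated, so dropping the signs and filling the gaps between the intervals
   only increases the variance of such a functional, which is at most S^(2H).

   A finite maximum M of affine functionals of a Gaussian vector X whose linear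
   parts have variance at most v concentrates by the Maurey-Pisier argument. Let Y
   be an independent copy of X, and X_t = cos t X + sin t Y. Cutting [0, pi/2] into
   K steps, Jensen's inequality and the rotation invariance of the law of
   (X_t, X_u) in u - t bound E exp(l (M(X) - M(Y))) by a single step
   E exp(l K (M(X_0) - M(X_(pi/2K)))); there M(X_0) - M(X_t) is at most
   (1 - cos t) X_j - sin t Y_j with j the index attaining M(X), and integrating over
   Y first gives exp(l^2 pi^2 v / 8) as K grows. Jensen's inequality in Y and
   Chernoff's bound give the tail 2 exp(-2 u^2 / (pi^2 v)), and a monotone limit
   passes from finite maxima to TV^c. The constants are A = 2 and B = 2 / pi^2. *)
Require Import Defs.
From mathcomp Require Import all_boot all_order all_algebra.
From mathcomp Require Import all_classical all_reals all_analysis.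
From mathcomp Require Import measurable_realfun.
From mathcomp Require Import ring lra.

Set Implicit Arguments.
Unset Strict Implicit.
Unset Printing Implicit Defensive.

Import Order.TTheory GRing.Theory Num.Theory.
Import numFieldNormedType.Exports.

Local Open Scope classical_set_scope.
Local Open Scope ring_scope.

(** * One-dimensional Gaussian integrals *)

(** The hypotheses give only one-dimensional laws of linear combinations, with unspecified
    parameters, whereas rotation invariance is an equality of joint laws of pairs (X_t, X_u). The
    parameters are recovered from moments. Joint laws are compared on Lipschitz functions: equality
    of E cos and E sin of all linear forms passes to trigonometric polynomials by linearity, then to
    Lipschitz functions by approximation with error e (1 + |x|^2), which finite second moments make
    harmless. Equality for linear forms holds because the variance of a.X_t + b.X_u depends on the
    angles only through cos (u - t). The rotation from X to Y has length pi/2, so a variance v acts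
    as (pi/2)^2 v; the Gaussian exponent u^2 / (2 (pi/2)^2 v) is the source of 2 / pi^2. In the
    limit, finiteness of the mean of TV^c comes from its almost sure finiteness and from the
    concentration of the finite maxima, which is uniform in n. The paths are continuous only off a
    null set and TV^c of the paths need not be measurable, so integrals and probabilities are
    compared up to null sets. *)

Section Density.
Context d (T : measurableType d) (R : realType).
Variables (mu nu : {measure set T -> \bar R}) (g : T -> R).
Hypotheses (mg : measurable_fun setT g) (g0 : forall x, 0 <= g x)
  (nuE : forall A, measurable A -> (nu A = \int[mu]_(x in A) (g x)%:E)%E).
Local Open Scope ereal_scope.
Import HBNNSimple.

Let integral_density_nnsfun (f : {nnsfun T >-> R}) :
  \int[nu]_x (f x)%:E = \int[mu]_x ((f x)%:E * (g x)%:E).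
Proof.
under [LHS]eq_integral do rewrite fimfunE -fsumEFin//.
rewrite [LHS]ge0_integral_fsum//; last 2 first.
  - by move=> r; exact/measurable_EFinP/measurableT_comp.
  - by move=> n x _; rewrite EFinM nnfun_muleindic_ge0.
under [RHS]eq_integral.
  move=> x xD; rewrite fimfunE -fsumEFin// ge0_mule_fsuml; last first.
    by move=> r; rewrite EFinM nnfun_muleindic_ge0.
  over.
rewrite [RHS]ge0_integral_fsum//; last 2 first.
  - move=> r; apply: emeasurable_funM; last exact/measurable_EFinP.
    by apply/measurable_EFinP; exact: measurableT_comp.
  - by move=> n x _; rewrite mule_ge0 ?lee_fin// -lee_fin EFinM nnfun_muleindic_ge0.
apply: eq_fsbigr => r _.
have mr : measurable (f @^-1` [set r]) by exact: measurable_funPTI.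
rewrite integralZl_indic_nnsfun//= integral_indic//= setIT nuE//.
under [RHS]eq_integral do rewrite EFinM -muleA.
have [r0|r0] := leP 0%R r; last first.
  rewrite preimage_nnfun0// integral_set0 mule0.
  by under eq_integral do rewrite indic0 mul0e mule0; rewrite integral0.
rewrite ge0_integralZl//; last 2 first.
  - by apply: emeasurable_funM; apply/measurable_EFinP => //; exact: measurable_indic.
  - by move=> x _; rewrite mule_ge0// lee_fin.
congr (_ * _); rewrite integral_mkcond; apply: eq_integral => x _.
by rewrite restrict_EFin/= /patch indicE; case: (x \in _); rewrite ?mul1e ?mul0e.
Qed.

Lemma ge0_integral_density (f : T -> \bar R) :
  measurable_fun setT f -> (forall x, 0 <= f x) ->
  \int[nu]_x f x = \int[mu]_x (f x * (g x)%:E).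
Proof.
move=> mf f0.
pose f_ := nnsfun_approx measurableT mf.
transitivity (lim (\int[nu]_x (f_ n x)%:E @[n --> \oo])).
  rewrite -monotone_convergence//=.
  - apply: eq_integral => ? /[!inE] xD; apply/esym/cvg_lim => //=.
    exact: cvg_nnsfun_approx.
  - by move=> n; exact/measurable_EFinP/measurable_funTS.
  - by move=> n ? _; rewrite lee_fin.
  - by move=> ? _ ? ? mn; rewrite lee_fin; exact/lefP/nd_nnsfun_approx.
transitivity (lim (\int[mu]_x ((f_ n x)%:E * (g x)%:E) @[n --> \oo])).
  by apply: congr_lim; apply/funext => n /=; exact: integral_density_nnsfun.
rewrite -monotone_convergence//=.
- apply: eq_integral => x _; apply/cvg_lim => //=.
  apply: cvgeZr => //; exact: cvg_nnsfun_approx.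
- by move=> n; apply: emeasurable_funM; exact/measurable_EFinP.
- by move=> n x _; rewrite mule_ge0 ?lee_fin.
- move=> x _ m n mn; rewrite lee_wpmul2r ?lee_fin//.
  exact/lefP/nd_nnsfun_approx.
Qed.

End Density.

Section GaussianIntegrals.
Context (R : realType).
Notation mu := (@lebesgue_measure R).
Implicit Types (m s t x a b : R).

(** The integral of [f] against [gaussian_law m s], with the same case split, so that point masses
    follow the same formulas as densities. *)
Definition gauss_int (f : R -> \bar R) m s : \bar R :=
  if s == 0 then f m else (\int[mu]_x (f x * (normal_pdf m s x)%:E))%E.

Lemma gauss_int0 f m : gauss_int f m 0 = f m.
Proof. by rewrite /gauss_int eqxx. Qed.

Lemma ge0_integral_gaussian d (T : measurableType d) (P : probability T R)
    (X : T -> R) m s (f : R -> \bar R) :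
  measurable_fun setT X ->
  (forall A, measurable A -> pushforward P X A = gaussian_law m s A) ->
  measurable_fun setT f -> (forall x, 0 <= f x)%E ->
  (\int[P]_w f (X w) = gauss_int f m s)%E.
Proof.
move=> mX lawX mf f0.
pose Y : {mfun T >-> measurableTypeR R} :=
  MeasurableFun.Pack (MeasurableFun.Class
    (isMeasurableFun.Build _ _ T (measurableTypeR R) X mX)).
have lawY A : measurable A -> distribution P Y A = gaussian_law m s A.
  exact: lawX.
rewrite -[LHS](ge0_integral_distribution Y mf f0) /gauss_int; case: ifPn => s0.
  rewrite (@eq_measure_integral _ _ _ setT
    (@dirac _ (measurableTypeR R) m R)) ?integral_dirac//.
    by rewrite diracT mul1e.
  by move=> A mA _; have := lawY A mA; rewrite /gaussian_law s0.
apply: ge0_integral_density => //.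
- exact: measurable_normal_pdf.
- exact: normal_pdf_ge0.
- by move=> A mA; have := lawY A mA; rewrite /gaussian_law (negbTE s0).
Qed.

(** Exponential tilting: completing the square moves the mean by t s^2. Integrating gives the moment
    generating function. *)
Lemma normal_pdf_expR m s t x : s != 0 ->
  expR (t * x) * normal_pdf m s x =
  expR (t * m + t ^+ 2 * s ^+ 2 / 2) * normal_pdf (m + t * s ^+ 2) s x.
Proof.
move=> s0; rewrite !normal_pdfE// [LHS]mulrCA [RHS]mulrCA; congr (_ * _).
by rewrite /normal_fun -!expRD; congr expR; field.
Qed.

Lemma gauss_int_expR m s t :
  gauss_int (fun x => (expR (t * x))%:E) m s =
  (expR (t * m + t ^+ 2 * s ^+ 2 / 2))%:E.
Proof.
rewrite /gauss_int; case: ifPn => [/eqP ->|s0].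
  by rewrite expr0n/= mulr0 mul0r addr0.
under eq_integral do rewrite -EFinM normal_pdf_expR// EFinM.
rewrite ge0_integralZl//.
- by rewrite integral_normal_pdf mule1.
- by apply/measurable_EFinP; exact: measurable_normal_pdf.
- by move=> x _; rewrite lee_fin normal_pdf_ge0.
Qed.

(** Quadratic tilting changes the standard deviation from [s] to [t], up to the ratio of the peaks.
    Since [t] may lie on either side of [s], it yields bounds on the second moment from both
    sides. *)
Lemma normal_pdf_expRN_sqr s t x : s != 0 -> t != 0 ->
  expR (- ((t ^- 2 - s ^- 2) / 2 * x ^+ 2)) * normal_pdf 0 s x =
  `|t / s| * normal_pdf 0 t x.
Proof.
move=> s0 t0; rewrite !normal_pdfE//.
have pk r : r != 0 -> normal_peak r = (Num.sqrt (pi *+ 2))^-1 / `|r| :> R.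
  move=> r0; rewrite /normal_peak -mulrnAr sqrtrM ?sqr_ge0// sqrtr_sqr.
  by rewrite invfM mulrC.
rewrite !pk// normrM normrV ?unitfE//.
rewrite [LHS]mulrCA /normal_fun -expRD.
have t0' : `|t| != 0 by rewrite normr_eq0.
have s0' : `|s| != 0 by rewrite normr_eq0.
rewrite !subr0.
have -> : - ((t ^- 2 - s ^- 2) / 2 * x ^+ 2) + - x ^+ 2 / (s ^+ 2 *+ 2) =
  - x ^+ 2 / (t ^+ 2 *+ 2) by field; rewrite s0 t0.
set z := (Num.sqrt _)^-1; set e := expR _.
by field; rewrite t0' s0'.
Qed.

Lemma gauss_int_expRN_sqr s t : 0 < s -> 0 < t ->
  gauss_int (fun x => (expR (- ((t ^- 2 - s ^- 2) / 2 * x ^+ 2)))%:E) 0 s =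
  (t / s)%:E.
Proof.
move=> s0 t0; rewrite /gauss_int gt_eqF//.
under eq_integral do rewrite -EFinM normal_pdf_expRN_sqr ?gt_eqF// EFinM.
rewrite ge0_integralZl//.
- by rewrite integral_normal_pdf mule1 ger0_norm// divr_ge0 ?ltW.
- by apply/measurable_EFinP; exact: measurable_normal_pdf.
- by move=> x _; rewrite lee_fin normal_pdf_ge0.
Qed.

(** The joint density of (X, X + Y), for X and Y independent and centered, factors as the marginal
    density of the sum times the conditional density of X given the sum. *)
Lemma normal_pdf_convolution a b x y : 0 < a -> 0 < b ->
  let c := Num.sqrt (a ^+ 2 + b ^+ 2) in
  normal_pdf 0 a x * normal_pdf x b y =
  normal_pdf 0 c y * normal_pdf (a ^+ 2 / c ^+ 2 * y) (a * b / c) x.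
Proof.
move=> a0 b0 c.
have cc : c ^+ 2 = a ^+ 2 + b ^+ 2 by rewrite sqr_sqrtr// addr_ge0 ?sqr_ge0.
have c0 : 0 < c by rewrite sqrtr_gt0 addr_gt0 ?exprn_gt0.
have pk r : 0 < r -> normal_peak r = (Num.sqrt (pi *+ 2))^-1 / r :> R.
  move=> r0; rewrite /normal_peak -mulrnAr sqrtrM ?sqr_ge0// sqrtr_sqr.
  by rewrite invfM mulrC gtr0_norm.
have abc0 : 0 < a * b / c by rewrite divr_gt0// mulr_gt0.
rewrite !normal_pdfE ?gt_eqF// !pk// /normal_fun.
rewrite mulrACA [RHS]mulrACA -!expRD; congr (_ * _).
  set z := (Num.sqrt _)^-1; field; by rewrite !gt_eqF.
congr expR; rewrite !expr_div_n !exprMn cc; field.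
by rewrite !gt_eqF// addr_gt0// exprn_gt0.
Qed.

Lemma gauss_int_shift x b (f : R -> R) : 0 < b ->
  continuous f -> (forall y, 0 <= f y) ->
  (\int[mu]_y ((f (x + y))%:E * (normal_pdf 0 b y)%:E) =
   \int[mu]_y ((f y)%:E * (normal_pdf x b y)%:E))%E.
Proof.
move=> b0 cf f0.
pose F (y : R^o) : R^o := x + y.
have dF y : derivable F y 1 by apply: derivableD.
have F'E : F^`()%classic = cst 1.
  apply/funext => y; rewrite derive1E deriveD// derive_cst add0r derive_id//.
under [RHS]eq_integral do rewrite -EFinM.
rewrite (@increasing_ge0_integration_by_substitutionT _ F
  (fun y => f y * normal_pdf x b y)).
- apply: eq_integral => y _; rewrite F'E -EFinM /= !fctE /= mulr1 /F.
  congr (_ * _)%:E.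
  by rewrite !normal_pdfE ?gt_eqF// /normal_fun subr0 addrC addKr.
- by move=> y z yz; rewrite ltrD2l.
- by rewrite F'E; move=> y; exact: cvg_cst.
- by rewrite F'E; exact: is_cvg_cst.
- by rewrite F'E; exact: is_cvg_cst.
- exact: dF.
- exact: cvg_addrl_Ny.
- exact: cvg_addrl.
- by move=> y; apply: cvgM; [exact: cf|apply: continuous_normal_pdf; rewrite gt_eqF].
- by move=> y; rewrite mulr_ge0// normal_pdf_ge0.
Qed.

(** After the factorization of the joint density and an exchange of integrals, the conditional
    density integrates to 1. A zero variance makes one of the two integrals an evaluation and is
    treated apart. *)
Lemma gauss_int_convolution a b (f : R -> R) : 0 <= a -> 0 <= b ->
  continuous f -> (forall y, 0 <= f y) ->
  gauss_int (fun x => gauss_int (fun y => (f (x + y))%:E) 0 b) 0 a =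
  gauss_int (fun x => (f x)%:E) 0 (Num.sqrt (a ^+ 2 + b ^+ 2)).
Proof.
rewrite 2!le_eqVlt => /predU1P[<- b0|a0 /predU1P[<-|b0]] cf f0.
- rewrite expr0n add0r sqrtr_sqr gauss_int0 ger0_norm; last by rewrite le_eqVlt.
  by under eq_fun do rewrite add0r.
- rewrite expr0n addr0 sqrtr_sqr (gtr0_norm a0).
  by under [in LHS]eq_fun do rewrite gauss_int0 addr0.
set c := Num.sqrt _.
have c0 : 0 < c by rewrite sqrtr_gt0 addr_gt0 ?exprn_gt0.
have mf : measurable_fun setT f by exact: continuous_measurable_fun.
rewrite /gauss_int (gt_eqF a0) (gt_eqF b0) (gt_eqF c0).
under eq_integral do rewrite gauss_int_shift//.
under eq_integral => x _.
  rewrite -ge0_integralZr//; last 3 first.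
  - apply/emeasurable_funM; first exact/measurable_EFinP.
    apply/measurable_EFinP; exact: measurable_normal_pdf.
  - by move=> y _; rewrite mule_ge0 ?lee_fin ?normal_pdf_ge0.
  - by rewrite lee_fin normal_pdf_ge0.
  under eq_integral => y _.
    rewrite -!EFinM -mulrA [X in f y * X]mulrC normal_pdf_convolution// -/c.
    rewrite mulrA EFinM.
    over.
  over.
rewrite (@fubini_tonelli _ _ _ _ _ mu mu (fun z => (f z.2 * normal_pdf 0 c z.2)%:E *
    (normal_pdf (a ^+ 2 / c ^+ 2 * z.2) (a * b / c) z.1)%:E)%E)/=; last 2 first.
- apply: emeasurable_funM; apply/measurable_EFinP.
    apply: measurable_funM; first exact: measurableT_comp.
    by apply: measurableT_comp; first exact: measurable_normal_pdf.
  (* The mean depends on the second variable here, so joint measurability is read off the explicit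
     density. *)
  rewrite (_ : (fun z => _) = fun z : R * R => normal_peak (a * b / c) *
      expR (- (z.1 - a ^+ 2 / c ^+ 2 * z.2) ^+ 2 / ((a * b / c) ^+ 2 *+ 2))).
    apply: measurable_funM => //; apply: measurableT_comp => //.
    apply: measurable_funM => //; apply: measurableT_comp => //.
    apply: measurable_funX; apply: measurable_funB => //.
    exact: measurable_funM.
  apply/funext => z; rewrite normal_pdfE//.
  by rewrite gt_eqF// divr_gt0// mulr_gt0.
- by move=> z; rewrite mule_ge0// lee_fin ?mulr_ge0 ?normal_pdf_ge0.
apply: eq_integral => y _.
rewrite ge0_integralZl//; last 3 first.
- by apply/measurable_EFinP; exact: measurable_normal_pdf.
- by move=> x _; rewrite lee_fin normal_pdf_ge0.
- by rewrite lee_fin mulr_ge0 ?normal_pdf_ge0.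
by rewrite integral_normal_pdf mule1 EFinM.
Qed.

End GaussianIntegrals.

(** * Moments of a Gaussian law *)

Section GaussianMoments.
Context (R : realType) d (T : measurableType d) (P : probability T R).
Implicit Types (X : T -> R) (m s t v : R).

Lemma expR_le1D2x v : 0 <= v <= 2^-1 -> expR v <= 1 + 2 * v.
Proof.
move=> /andP[v0 v2].
have h1 : 1 - v <= expR (- v) by have := expR_ge1Dx (- v).
have h2 := expR_gt0 (- v).
have -> : expR v = (expR (- v))^-1 by rewrite expRN invrK.
rewrite -[leLHS]mul1r ler_pdivrMr//; nra.
Qed.

(* Both sides equal 1 at t = 0, where the right-hand side has derivative 0. *)
Lemma expR_sqr_majorant_eq0 (x v : R) : 0 <= v ->
  (forall t : R, 1 + t * x <= expR (t ^+ 2 * v)) -> x = 0.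
Proof.
move=> v0 H; apply/eqP; rewrite -sqrf_eq0; apply/eqP.
have x2 : 0 <= x ^+ 2 by exact: sqr_ge0.
(* This makes e v and e x^2 at most 1/4. At t = e x the hypothesis then gives e x^2 <= 2 (e x^2) (e
   v) <= e x^2 / 2, hence x = 0. *)
pose e := (4 * (1 + v) * (1 + x ^+ 2))^-1.
have D0 : 0 < 4 * (1 + v) * (1 + x ^+ 2) by nra.
have e0 : 0 < e by rewrite invr_gt0.
have eD : e * (4 * (1 + v) * (1 + x ^+ 2)) = 1 by rewrite mulVf// gt_eqF.
have ev : e * v <= 4^-1.
  suff : e * (4 * (1 + v)) <= 1 by nra.
  rewrite -[leRHS]eD ler_pM2l//; nra.
have ex : e * x ^+ 2 <= 4^-1.
  suff : e * (4 * (1 + x ^+ 2)) <= 1 by nra.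
  rewrite -[leRHS]eD ler_pM2l//; nra.
have y0 : 0 <= (e * x) ^+ 2 * v by rewrite mulr_ge0// sqr_ge0.
have y2 : (e * x) ^+ 2 * v <= 2^-1.
  rewrite (_ : _ * v = (e * x ^+ 2) * (e * v)); last by ring.
  apply: (@le_trans _ _ (4^-1 * 4^-1)); last by lra.
  by apply: ler_pM => //; rewrite mulr_ge0// ltW.
have := H (e * x); have := @expR_le1D2x ((e * x) ^+ 2 * v); rewrite y0 y2.
move=> /(_ isT) h1 h2.
have {h1 h2} h : e * x ^+ 2 <= 2 * (e * x ^+ 2) * (e * v) by nra.
nra.
Qed.

Lemma Rintegral_cst_probability v : \int[P]_w v = v.
Proof. by have := expectation_cst P v; rewrite unlock /Rintegral /= => ->. Qed.

Section Law.
Variables (X : T -> R) (m s : R).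
Hypotheses (mX : measurable_fun setT X) (s0 : 0 <= s)
  (lawX : forall A, measurable A -> pushforward P X A = gaussian_law m s A).

Lemma gaussian_mgf t :
  (\int[P]_w (expR (t * X w))%:E = (expR (t * m + t ^+ 2 * s ^+ 2 / 2))%:E)%E.
Proof.
rewrite (ge0_integral_gaussian mX lawX (f := fun x => (expR (t * x))%:E)).
- exact: gauss_int_expR.
- by apply/measurable_EFinP; apply: measurableT_comp => //; exact: measurable_funM.
- by move=> x; rewrite lee_fin expR_ge0.
Qed.

Lemma gaussian_integrable_expR t : P.-integrable setT (fun w => (expR (t * X w))%:E).
Proof.
apply/integrableP; split.
  by apply/measurable_EFinP; apply: measurableT_comp => //; exact: measurable_funM.
under eq_integral do rewrite /= ger0_norm ?expR_ge0//.
by rewrite gaussian_mgf ltry.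
Qed.

(** A common dominating function, up to a constant, for X and X^2. *)
Lemma gaussian_integrable_cosh :
  P.-integrable setT (fun w => (expR (X w) + expR (- X w))%:E).
Proof.
apply: (eq_integrable measurableT (fun w => (expR (1 * X w))%:E + (expR (-1 * X w))%:E)%E).
  by move=> w _; rewrite mul1r mulN1r EFinD.
by apply: integrableD => //; exact: gaussian_integrable_expR.
Qed.

Lemma gaussian_integrable : P.-integrable setT (EFin \o X).
Proof.
apply: (le_integrable _ _ _ gaussian_integrable_cosh) => //; first exact/measurable_EFinP.
move=> w _; rewrite /= lee_fin [leRHS]ger0_norm ?addr_ge0 ?expR_ge0//.
have h1 := expR_ge1Dx (X w); have h2 := expR_ge1Dx (- X w).
have h3 := expR_gt0 (X w); have h4 := expR_gt0 (- X w).
by rewrite ler_norml; apply/andP; split; lra.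
Qed.

Lemma gaussian_integrable_sqr : P.-integrable setT (fun w => (X w ^+ 2)%:E).
Proof.
apply: (le_integrable _ _ _ (integrableZl measurableT 2 gaussian_integrable_cosh)) => //.
  by apply/measurable_EFinP; exact: measurable_funX.
move=> w _; rewrite /= lee_fin !ger0_norm ?sqr_ge0 ?mulr_ge0 ?addr_ge0 ?expR_ge0//.
have aux (x : R) : 0 <= x -> x ^+ 2 <= 2 * expR x.
  move=> x0; have := @expR_ge1Dxn _ x 1 x0.
  by rewrite (_ : 2`!%:R = 2 :> R)//; lra.
have [x0|x0] := leP 0 (X w).
  by have := aux _ x0; have := expR_gt0 (- X w); lra.
by have := aux (- X w); rewrite sqrrN; have := expR_gt0 (X w); lra.
Qed.

(** For every t, 1 + t (E X - m) <= E exp(t (X - m)) = exp(t^2 s^2 / 2); a line below this curve and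
    touching it at t = 0 has slope 0. *)
Lemma gaussian_mean : \int[P]_w X w = m.
Proof.
apply/eqP; rewrite -subr_eq0; apply/eqP.
apply: (@expR_sqr_majorant_eq0 _ (s ^+ 2 / 2)); first by rewrite divr_ge0// sqr_ge0.
move=> t.
have -> : 1 + t * (\int[P]_w X w - m) = \int[P]_w (1 - t * m + t * X w).
  rewrite RintegralD//; last 2 first.
  - exact: finite_measure_integrable_cst.
  - exact: (integrableZl measurableT t gaussian_integrable).
  rewrite RintegralZl//; last exact: gaussian_integrable.
  by rewrite Rintegral_cst_probability; ring.
have -> : expR (t ^+ 2 * (s ^+ 2 / 2)) = \int[P]_w (expR (- (t * m)) * expR (t * X w)).
  rewrite RintegralZl//; last exact: gaussian_integrable_expR.
  rewrite /Rintegral gaussian_mgf /= -expRD; congr expR; ring.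
apply: le_Rintegral => //.
- apply: (eq_integrable measurableT (fun w => (1 - t * m)%:E + t%:E * (X w)%:E)%E) => //.
  apply: integrableD => //; first exact: finite_measure_integrable_cst.
  exact: (integrableZl measurableT t gaussian_integrable).
- exact: (integrableZl measurableT _ (gaussian_integrable_expR t)).
- move=> w _; rewrite -expRD; apply: le_trans (expR_ge1Dx _).
  by rewrite le_eqVlt; apply/orP; left; apply/eqP; ring.
Qed.

Hypothesis m0 : m = 0.

(** E (1 - h X^2) <= E exp(- h X^2) = t / s, where h = (t^-2 - s^-2) / 2 takes both signs as t
    varies around s; this squeezes E X^2 from both sides. *)
Lemma gaussian_second_moment : \int[P]_w (X w ^+ 2) = s ^+ 2.
Proof.
have [s_eq0|s_gt0] : s = 0 \/ 0 < s.
  by move: s0; rewrite le_eqVlt => /predU1P[<-|]; [left|right].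
  rewrite /Rintegral (ge0_integral_gaussian mX lawX (f := fun x => (x ^+ 2)%:E)).
  - by rewrite s_eq0 gauss_int0 m0.
  - by apply/measurable_EFinP; exact: measurable_funX.
  - by move=> x; rewrite lee_fin sqr_ge0.
set q := \int[P]_w _.
have q0 : 0 <= q by apply: Rintegral_ge0 => w _; exact: sqr_ge0.
have key t : 0 < t -> 1 - (t ^- 2 - s ^- 2) / 2 * q <= t / s.
  move=> t0; set h := (_ / 2).
  have E : (\int[P]_w (expR (- (h * X w ^+ 2)))%:E = (t / s)%:E)%E.
    rewrite (ge0_integral_gaussian mX lawX (f := fun x => (expR (- (h * x ^+ 2)))%:E)).
    - by rewrite m0 gauss_int_expRN_sqr.
    - apply/measurable_EFinP; apply: measurableT_comp => //.
      by apply: measurableT_comp => //; apply: measurable_funM.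
    - by move=> x; rewrite lee_fin expR_ge0.
  have -> : t / s = \int[P]_w expR (- (h * X w ^+ 2)) by rewrite /Rintegral E.
  have -> : 1 - h * q = \int[P]_w (1 - h * X w ^+ 2).
    rewrite RintegralB//; last 2 first.
    - exact: finite_measure_integrable_cst.
    - exact: (integrableZl measurableT h gaussian_integrable_sqr).
    rewrite RintegralZl//; last exact: gaussian_integrable_sqr.
    by rewrite Rintegral_cst_probability.
  apply: le_Rintegral => //.
  - apply: (eq_integrable measurableT (fun w => 1%:E - h%:E * (X w ^+ 2)%:E)%E) => //.
    apply: integrableB => //; first exact: finite_measure_integrable_cst.
    exact: (integrableZl measurableT h gaussian_integrable_sqr).
  - apply/integrableP; split.
      apply/measurable_EFinP; apply: measurableT_comp => //.
      apply: measurableT_comp => //; apply: measurable_funM => //.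
      exact: measurable_funX.
    under eq_integral do rewrite /= ger0_norm ?expR_ge0//.
    by rewrite E ltry.
  - by move=> w _; exact: expR_ge1Dx.
have key2 t : 0 < t -> 2 * s * t ^+ 2 * (s - t) <= (s ^+ 2 - t ^+ 2) * q.
  move=> t0; have := key t t0.
  have -> : 1 - (t ^- 2 - s ^- 2) / 2 * q =
    t / s + (2 * s * t ^+ 2 * (s - t) - (s ^+ 2 - t ^+ 2) * q) / (2 * s ^+ 2 * t ^+ 2).
    by field; rewrite !gt_eqF.
  rewrite gerDl pmulr_lle0 ?subr_le0//.
  by rewrite invr_gt0 !mulr_gt0// exprn_gt0.
apply/eqP; rewrite eq_le; apply/andP; split; rewrite leNgt; apply/negP => lt.
(* With t^2 halfway between s^2 and q, dividing [key2] by s - t < 0 gives (s + t) q <= 2 s t^2,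
   although s < t and t^2 < q. The other case is symmetric. *)
- pose t := Num.sqrt ((q + s ^+ 2) / 2).
  have s20 : 0 < s ^+ 2 by exact: exprn_gt0.
  have t2 : t ^+ 2 = (q + s ^+ 2) / 2 by rewrite sqr_sqrtr//; lra.
  have t0 : 0 < t by rewrite sqrtr_gt0; lra.
  have st : s < t by rewrite -(ltr_pXn2r (n := 2)) ?nnegrE ?ltW// t2; lra.
  have := key2 _ t0.
  rewrite (_ : s ^+ 2 - t ^+ 2 = (s + t) * (s - t)); last by ring.
  rewrite -mulrA [X in _ <= X](_ : _ = ((s + t) * q) * (s - t)); last by ring.
  rewrite mulrA ler_nM2r ?subr_lt0//; nra.
- pose t := Num.sqrt ((q + s ^+ 2) / 2).
  have s20 : 0 < s ^+ 2 by exact: exprn_gt0.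
  have t2 : t ^+ 2 = (q + s ^+ 2) / 2 by rewrite sqr_sqrtr//; lra.
  have t0 : 0 < t by rewrite sqrtr_gt0; lra.
  have st : t < s by rewrite -(ltr_pXn2r (n := 2)) ?nnegrE ?ltW// t2; lra.
  have := key2 _ t0.
  rewrite (_ : s ^+ 2 - t ^+ 2 = (s + t) * (s - t)); last by ring.
  rewrite -mulrA [X in _ <= X](_ : _ = ((s + t) * q) * (s - t)); last by ring.
  rewrite mulrA ler_pM2r ?subr_gt0//; nra.
Qed.

End Law.
End GaussianMoments.

(** * The Cramer-Wold device *)

Section TrigApprox.
Context (R : realType).

Lemma ler_norm_sin (y : R) : `|sin y| <= `|y|.
Proof.
wlog y0 : y / 0 <= y => [H|].
  have [/H//|y0] := leP 0 y.
  by have := H (- y); rewrite sinN !normrN; apply; rewrite oppr_ge0 ltW.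
have [z _] := @MVT_segment R sin cos 0 y y0 (fun x _ => is_derive_sin x)
  (continuous_subspaceT (@continuous_sin R)).
rewrite sin0 !subr0 => ->; rewrite normrM ler_piMl//.
by rewrite ler_norml cos_geN1 cos_le1.
Qed.

(** The exponent 2, rather than the cubic order at 0, keeps the error within reach of second moments
    for large y. *)
Lemma ler_norm_subr_sin (y : R) : `|y - sin y| <= y ^+ 2.
Proof.
wlog y0 : y / 0 <= y => [H|].
  have [/H//|y0] := leP 0 y.
  have := H (- y); rewrite sinN sqrrN -opprB opprK addrC normrN addrC -normrN.
  by apply; rewrite oppr_ge0 ltW.
have dg (x : R) : x \in `]0, y[ -> is_derive x 1 (fun x => x - sin x) (1 - cos x).
  by move=> _; apply: is_deriveB.
have cg : {within `[0, y], continuous (fun x : R => x - sin x)}.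
  apply: continuous_subspaceT => x.
  by apply: cvgB; [exact: cvg_id|exact: continuous_sin].
have [z z0y] := MVT_segment y0 dg cg.
rewrite sin0 !subr0 => ->; rewrite normrM (ger0_norm y0) expr2 ler_wpM2r//.
have zy : 0 <= z <= y by move: z0y; rewrite in_itv.
have -> : 1 - cos z = 2 * sin (z / 2) ^+ 2.
  have E : z = (z / 2) *+ 2 by rewrite -mulr_natr divfK.
  rewrite {1}E cos_mulr2n.
  by have := cos2Dsin2 (z / 2); lra.
have h1 := ler_norm_sin (z / 2).
have h2 : `|sin (z / 2)| <= 1 by rewrite ler_norml sin_geN1 sin_le1.
rewrite -real_normK ?num_real// ger0_norm ?mulr_ge0 ?sqr_ge0//.
have h3 := normr_ge0 (sin (z / 2)).
rewrite (ger0_norm (x := z / 2)) in h1; nra.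
Qed.

Variable I : finType.
Implicit Types (a x y z s : I -> R) (f g : (I -> R) -> R).

(** Only linear operations are constructors, so that an identity between characteristic functions
    extends to the whole class by induction. Products come from the product-to-sum formulas. *)
Inductive trig_poly : ((I -> R) -> R) -> Prop :=
| trig_cos a : trig_poly (fun x => cos (\sum_i a i * x i))
| trig_sin a : trig_poly (fun x => sin (\sum_i a i * x i))
| trig_add f g : trig_poly f -> trig_poly g -> trig_poly (fun x => f x + g x)
| trig_scale c f : trig_poly f -> trig_poly (fun x => c * f x).

Lemma trig_cst c : trig_poly (fun=> c).
Proof.
rewrite (_ : (fun=> c) = fun x => c * cos (\sum_i 0 * x i)).
  exact/trig_scale/trig_cos.
apply/funext => x; rewrite big1 ?cos0 ?mulr1// => i _.
by rewrite mul0r.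
Qed.

Let dotD a b x : \sum_i (a i + b i) * x i = \sum_i a i * x i + \sum_i b i * x i.
Proof. by rewrite -big_split; apply: eq_bigr => i _; rewrite mulrDl. Qed.

Let dotB a b x : \sum_i (a i - b i) * x i = \sum_i a i * x i - \sum_i b i * x i.
Proof. by rewrite -sumrB; apply: eq_bigr => i _; rewrite mulrBl. Qed.

Lemma trig_mul_sin a f :
  trig_poly f -> trig_poly (fun x => sin (\sum_i a i * x i) * f x).
Proof.
elim=> [b|b|g h _ IHg _ IHh|c g _ IHg].
- rewrite (_ : (fun x => _) = fun x => 2^-1 * sin (\sum_i (b i + a i) * x i) +
    (- 2^-1) * sin (\sum_i (b i - a i) * x i)).
    by apply: trig_add; apply: trig_scale; exact: trig_sin.
  apply/funext => x.
  by rewrite dotD dotB sinB sinD; lra.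
- rewrite (_ : (fun x => _) = fun x => 2^-1 * cos (\sum_i (b i - a i) * x i) +
    (- 2^-1) * cos (\sum_i (b i + a i) * x i)).
    by apply: trig_add; apply: trig_scale; exact: trig_cos.
  apply/funext => x.
  by rewrite dotB dotD cosB cosD; lra.
- rewrite (_ : (fun x => _) = fun x => sin (\sum_i a i * x i) * g x +
    sin (\sum_i a i * x i) * h x); first exact: trig_add.
  by apply/funext => x; rewrite mulrDr.
- rewrite (_ : (fun x => _) = fun x => c * (sin (\sum_i a i * x i) * g x)).
    exact: trig_scale.
  by apply/funext => x; rewrite mulrCA.
Qed.

Section Bernstein.
Variables (f : (I -> R) -> R) (M h : R).

(** A success probability that is itself a trigonometric polynomial in [x]. *)
Definition bern_weight x (j : I) : R := (1 + sin (x j / M)) / 2.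

Lemma bern_weight_itv x j : 0 <= bern_weight x j <= 1.
Proof.
rewrite /bern_weight; have := sin_geN1 (x j / M); have := sin_le1 (x j / M).
by move=> ? ?; apply/andP; split; lra.
Qed.

(* The mean of [f] at the point whose i-th coordinate is [s i] plus [h] times a
   binomial variable with parameters [count_mem i js] and [bern_weight x i]; it is
   a trigonometric polynomial in [x]. *)
Fixpoint bernstein (js : seq I) s x : R :=
  if js is j :: js' then
    bern_weight x j * bernstein js' (fun i => s i + (i == j)%:R * h) x +
    (1 - bern_weight x j) * bernstein js' s x
  else f s.

Lemma trig_bern_weight j g : trig_poly g -> trig_poly (fun x => bern_weight x j * g x).
Proof.
move=> tg; rewrite (_ : (fun x => _) = fun x => 2^-1 * g x +
    2^-1 * (sin (\sum_i ((i == j)%:R / M) * x i) * g x)).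
  by apply: trig_add; apply: trig_scale => //; exact: trig_mul_sin.
apply/funext => x; rewrite (bigD1 j)//= eqxx big1 => [|i /negPf ->].
  by rewrite addr0 mul1r /bern_weight [M^-1 * _]mulrC; lra.
by rewrite !mul0r.
Qed.

Lemma trig_bernstein js s : trig_poly (bernstein js s).
Proof.
elim: js s => [|j js IH] s /=; first exact: trig_cst.
apply: trig_add; first exact: trig_bern_weight.
rewrite (_ : (fun x => _) = fun x => bernstein js s x +
  (-1) * (bern_weight x j * bernstein js s x)).
  by apply: trig_add => //; apply: trig_scale; exact: trig_bern_weight.
by apply/funext => x; ring.
Qed.

(** Squared bias plus variance: the mean square distance from the random point to [y] is the squared
    distance from its mean to [y], plus at most h^2 / 4 for each Bernoulli step. *)
Lemma bernstein_approx e C js s x y : 0 <= C ->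
  (forall z, `|f z - f y| <= e + C * \sum_i (z i - y i) ^+ 2) ->
  `|bernstein js s x - f y| <= e + C *
    (\sum_i (s i + h * (count_mem i js)%:R * bern_weight x i - y i) ^+ 2 +
     (size js)%:R * h ^+ 2 / 4).
Proof.
move=> C0 fC; elim: js s => [|j js IH] s /=.
  rewrite mul0r mul0r addr0; apply: le_trans (fC s) _.
  by under [X in _ <= _ + _ * X]eq_bigr do rewrite mulr0 mul0r addr0.
set v := bern_weight x j; have /andP[v0 v1] : 0 <= v <= 1 by exact: bern_weight_itv.
set A := bernstein _ _ _; set B := bernstein _ _ _.
have -> : v * A + (1 - v) * B - f y = v * (A - f y) + (1 - v) * (B - f y) by ring.
apply: le_trans (ler_normD _ _) _.
have v1' : 0 <= 1 - v by rewrite subr_ge0.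
rewrite [X in X + _ <= _]normrM [X in _ + X <= _]normrM ger0_norm// (ger0_norm v1').
have hA := IH (fun i => s i + (i == j)%:R * h); have hB := IH s.
apply: le_trans (lerD (ler_wpM2l v0 hA) (ler_wpM2l v1' hB)) _.
set SA := \sum_i _; set SB := \sum_i _; set S := \sum_i _.
have SE : v * SA + (1 - v) * SB = S + h ^+ 2 * (v * (1 - v)).
  rewrite /SA /SB !mulr_sumr -big_split/=.
  have -> : h ^+ 2 * (v * (1 - v)) = \sum_i (i == j)%:R * (h ^+ 2 * (v * (1 - v))).
    rewrite (bigD1 j)//= eqxx mul1r big1 ?addr0// => i /negPf ->.
    by rewrite mul0r.
  rewrite -big_split/=; apply: eq_bigr => i _.
  rewrite natrD [j == i]eq_sym; case: eqP => [->|_]; rewrite -?/v /=; ring.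
have vv : v * (1 - v) <= 4^-1 by have := sqr_ge0 (v - 2^-1); nra.
have h2 : 0 <= h ^+ 2 by exact: sqr_ge0.
have -> : (size js).+1%:R = 1 + (size js)%:R :> R by rewrite -natr1 addrC.
set n := (size js)%:R.
have -> : v * (e + C * (SA + n * h ^+ 2 / 4)) + (1 - v) * (e + C * (SB + n * h ^+ 2 / 4)) =
  e + C * ((v * SA + (1 - v) * SB) + n * h ^+ 2 / 4) by ring.
rewrite SE lerD2l ler_wpM2l//; nra.
Qed.

End Bernstein.

(* With [s = - M] and [h = 2 M / n], the binomial means are [M sin (x i / M)], which
   is [x i] up to a quadratic error: hence the weight [1 + \sum_i x i ^+ 2]. *)
Lemma trig_approx f L e : 0 < e ->
  (forall z y, `|f z - f y| <= L * \sum_i `|z i - y i|) ->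
  exists2 Q, trig_poly Q & forall x, `|f x - Q x| <= e * (1 + \sum_i x i ^+ 2).
Proof.
move=> e0 fL0.
pose K : R := 1 + `|L|.
have K0 : 0 < K by rewrite ltr_wpDr.
have fL z y : `|f z - f y| <= K * \sum_i `|z i - y i|.
  apply: le_trans (fL0 z y) _; apply: ler_wpM2r; first exact: sumr_ge0.
  by rewrite /K; have := ler_norm L; lra.
pose N : R := 1 + #|I|%:R.
have N0 : 0 < N by rewrite ltr_wpDr.
(* Young's inequality K t <= al + C t^2 turns the Lipschitz bound into a quadratic one; [al] is such
   that all coordinates together cost at most e / 2. *)
pose al : R := e / (2 * N).
have al0 : 0 < al by rewrite divr_gt0// mulr_gt0.
pose C : R := K ^+ 2 / (4 * al).
have C0 : 0 < C by rewrite divr_gt0 ?exprn_gt0// mulr_gt0.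
have fC y z : `|f z - f y| <= e / 2 + C * \sum_i (z i - y i) ^+ 2.
  have -> : e / 2 = al * N by rewrite /al; field; rewrite gt_eqF.
  apply: le_trans (fL z y) _.
  apply: (@le_trans _ _ (\sum_(i : I) (al + C * (z i - y i) ^+ 2))).
    rewrite mulr_sumr; apply: ler_sum => i _.
    rewrite -[X in _ <= _ + _ * X]real_normK ?num_real//.
    set t := `|_|.
    have -> : al + C * t ^+ 2 = K * t + (K * t - 2 * al) ^+ 2 / (4 * al).
      by rewrite /C; field; rewrite gt_eqF.
    by rewrite lerDl divr_ge0 ?sqr_ge0// mulr_ge0// ltW.
  rewrite big_split/= -[X in _ + X <= _]mulr_sumr lerD2r sumr_const.
  by rewrite /N mulrDr mulr1 -(mulr_natr al) lerDr ltW.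
(* Then K M (x_i / M)^2 = e x_i^2, the allowed error of replacing x_i by M sin (x_i / M). *)
pose M : R := K / e.
have M0 : 0 < M by rewrite divr_gt0.
(* Large enough for the total variance term C #|I| M^2 / n to be at most e / 2. *)
pose n := (Num.bound (2 * C * #|I|%:R * M ^+ 2 / e)).+1.
have n0 : 0 < n%:R :> R by rewrite ltr0n.
have hn : C * (#|I|%:R * M ^+ 2 / n%:R) <= e / 2.
  have : 2 * C * #|I|%:R * M ^+ 2 / e <= n%:R.
    rewrite ltW//; apply: lt_trans (archi_boundP _) _; last by rewrite ltr_nat.
    by rewrite divr_ge0 ?(ltW e0)// mulr_ge0 ?sqr_ge0// mulr_ge0// mulr_ge0// ltW.
  rewrite ler_pdivrMr// => hn.
  rewrite mulrA ler_pdivrMr//; nra.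
pose js := flatten (nseq n (enum I)).
have cjs i : count_mem i js = n.
  rewrite /js count_flatten map_nseq sumnE big_nseq.
  rewrite count_uniq_mem ?enum_uniq// mem_enum.
  by rewrite iter_addn addn0 mul1n.
have sjs : size js = (n * #|I|)%N.
  by rewrite size_flatten /shape map_nseq -cardE sumnE big_nseq iter_addn addn0 mulnC.
pose h : R := 2 * M / n%:R.
exists (bernstein f M h js (fun=> - M)); first exact: trig_bernstein.
move=> x; pose y i := M * sin (x i / M).
have h1 : `|f x - f y| <= e * \sum_i x i ^+ 2.
  apply: le_trans (fL x y) _; rewrite !mulr_sumr; apply: ler_sum => i _.
  have -> : x i - y i = M * (x i / M - sin (x i / M)).
    by rewrite /y mulrBr mulrCA divff ?gt_eqF// mulr1.
  rewrite normrM (gtr0_norm M0).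
  have := ler_norm_subr_sin (x i / M).
  move=> /(ler_wpM2l (ltW M0)) /(ler_wpM2l (ltW K0)) /le_trans; apply.
  by rewrite le_eqVlt; apply/orP; left; apply/eqP; rewrite /M; field; rewrite !gt_eqF.
have h2 := @bernstein_approx f M h _ _ js (fun=> - M) x y (ltW C0) (fC y).
(* The binomial mean is exactly [y]: there is no bias, only variance. *)
rewrite big1 ?add0r in h2; last first.
  move=> i _; rewrite cjs /h /bern_weight /y.
  by rewrite (_ : _ - _ = 0) ?expr0n//; field; rewrite gt_eqF.
have h3 : C * ((size js)%:R * h ^+ 2 / 4) <= e / 2.
  apply: le_trans hn; rewrite sjs natrM /h le_eqVlt; apply/orP; left; apply/eqP.
  by field; rewrite gt_eqF.
rewrite distrC in h2.
have := ler_distD (f y) (f x) (bernstein f M h js (fun=> - M) x).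
rewrite mulrDr mulr1; lra.
Qed.

End TrigApprox.

(** * From characteristic functions to expectations of Lipschitz functions *)

Section CramerWold.
Context (R : realType) (I : finType).
Implicit Types (f Q : (I -> R) -> R).

Definition vec (T : Type) (X : I -> T -> R) (w : T) : I -> R := fun i => X i w.

Section Integrable.
Context d (T : measurableType d) (P : probability T R) (X : I -> T -> R).
Hypothesis mX : forall i, measurable_fun setT (X i).

Lemma measurable_lincomb (a : I -> R) :
  measurable_fun setT (fun w => \sum_i a i * X i w).
Proof. by apply: measurable_sum => i; exact: measurable_funM. Qed.

Lemma bounded_integrable (g : T -> R) b : measurable_fun setT g ->
  (forall w, `|g w| <= b) -> P.-integrable setT (EFin \o g).
Proof.
move=> mg gb; apply: (@le_integrable _ _ _ P _ measurableT _ (fun=> b%:E)).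
- exact/measurable_EFinP.
- by move=> w _; rewrite /= lee_fin (le_trans (gb w))// ler_norm.
- exact: finite_measure_integrable_cst.
Qed.

Lemma trig_poly_measurable Q : trig_poly Q ->
  measurable_fun setT (Q \o vec X) /\ exists b, forall x, `|Q x| <= b.
Proof.
elim=> [a|a|g h _ [mg [b gb]] _ [mh [b' hb]]|c g _ [mg [b gb]]]; split.
- apply: (measurableT_comp (f := cos)); last exact: measurable_lincomb.
  exact: continuous_measurable_fun (@continuous_cos R).
- by exists 1 => x; rewrite ler_norml cos_geN1 cos_le1.
- apply: (measurableT_comp (f := sin)); last exact: measurable_lincomb.
  exact: continuous_measurable_fun (@continuous_sin R).
- by exists 1 => x; rewrite ler_norml sin_geN1 sin_le1.
- exact: measurable_funD mg mh.
- by exists (b + b') => x; apply: le_trans (ler_normD _ _) _; exact: lerD.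
- exact: measurable_funM.
- by exists (`|c| * b) => x; rewrite normrM ler_wpM2l.
Qed.

Lemma trig_poly_integrable Q : trig_poly Q -> P.-integrable setT (EFin \o (Q \o vec X)).
Proof.
move=> /trig_poly_measurable[mQ [b Qb]].
by apply: (bounded_integrable (b := b)) => // w; exact: Qb.
Qed.

Hypothesis X2 : forall i, P.-integrable setT (fun w => (X i w ^+ 2)%:E).

Lemma sum_sqr_integrable :
  P.-integrable setT (fun w => (1 + \sum_i X i w ^+ 2)%:E).
Proof.
apply: (eq_integrable measurableT (fun w => 1%:E + \sum_i (X i w ^+ 2)%:E)%E).
  by move=> w _; rewrite EFinD sumEFin.
apply: integrableD => //; first exact: finite_measure_integrable_cst.
exact: integrable_sum.
Qed.

Lemma trig_approx_Rintegral f Q e : 0 <= e -> trig_poly Q ->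
  measurable_fun setT (f \o vec X) ->
  (forall x, `|f x - Q x| <= e * (1 + \sum_i x i ^+ 2)) ->
  `|\int[P]_w f (vec X w) - \int[P]_w Q (vec X w)| <=
    e * \int[P]_w (1 + \sum_i X i w ^+ 2).
Proof.
move=> e0 tQ mf fQ.
have iQ := trig_poly_integrable tQ.
have iS := sum_sqr_integrable.
have ieS : P.-integrable setT (fun w => (e * (1 + \sum_i X i w ^+ 2))%:E).
  exact: (integrableZl measurableT e iS).
have ifQ : P.-integrable setT (EFin \o (fun w => f (vec X w) - Q (vec X w))).
  apply: (le_integrable _ _ _ ieS) => //.
    apply/measurable_EFinP; apply: measurable_funB => //.
    by have [] := trig_poly_measurable tQ.
  by move=> w _; rewrite /= lee_fin; apply: le_trans (ler_norm _); exact: fQ.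
have if_ : P.-integrable setT (EFin \o (f \o vec X)).
  apply: (eq_integrable measurableT _ _ _ (integrableD measurableT ifQ iQ)).
  by move=> w _; rewrite /= -EFinD subrK.
rewrite -RintegralB// -RintegralZl//.
apply: (le_trans (le_normr_Rintegral measurableT ifQ)).
apply: le_Rintegral => //.
  exact: (integrable_abse ifQ).
Qed.

End Integrable.

Context d1 (T1 : measurableType d1) (P1 : probability T1 R) (X : I -> T1 -> R).
Context d2 (T2 : measurableType d2) (P2 : probability T2 R) (Y : I -> T2 -> R).
Hypotheses (mX : forall i, measurable_fun setT (X i))
           (mY : forall i, measurable_fun setT (Y i)).
Hypotheses (X2 : forall i, P1.-integrable setT (fun w => (X i w ^+ 2)%:E))
           (Y2 : forall i, P2.-integrable setT (fun w => (Y i w ^+ 2)%:E)).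
Hypotheses
  (cosXY : forall a : I -> R, \int[P1]_w cos (\sum_i a i * X i w) =
                              \int[P2]_w cos (\sum_i a i * Y i w))
  (sinXY : forall a : I -> R, \int[P1]_w sin (\sum_i a i * X i w) =
                              \int[P2]_w sin (\sum_i a i * Y i w)).

Lemma cramer_wold_trig Q : trig_poly Q ->
  \int[P1]_w Q (vec X w) = \int[P2]_w Q (vec Y w).
Proof.
elim=> [a|a|f g tf IHf tg IHg|c f tf IHf].
- exact: cosXY.
- exact: sinXY.
- by rewrite !RintegralD ?IHf ?IHg//; exact: trig_poly_integrable.
- by rewrite !RintegralZl ?IHf//; exact: trig_poly_integrable.
Qed.

(** A trigonometric polynomial within e (1 + |x|^2) of [f] has the same expectation under both laws,
    so the two expectations of [f] differ by at most e (S1 + S2), for every e > 0. *)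
Lemma cramer_wold f L :
  (forall z y, `|f z - f y| <= L * \sum_i `|z i - y i|) ->
  measurable_fun setT (f \o vec X) -> measurable_fun setT (f \o vec Y) ->
  \int[P1]_w f (vec X w) = \int[P2]_w f (vec Y w).
Proof.
move=> fL mfX mfY; apply/eqP; rewrite -subr_eq0 -normr_le0.
set z := `|_|.
pose S1 := \int[P1]_w (1 + \sum_i X i w ^+ 2).
pose S2 := \int[P2]_w (1 + \sum_i Y i w ^+ 2).
have S10 : 0 <= S1.
  by apply: Rintegral_ge0 => w _; rewrite addr_ge0// sumr_ge0// => i _; exact: sqr_ge0.
have S20 : 0 <= S2.
  by apply: Rintegral_ge0 => w _; rewrite addr_ge0// sumr_ge0// => i _; exact: sqr_ge0.
have H e : 0 < e -> z <= e * (S1 + S2).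
  move=> e0; have [Q tQ fQ] := trig_approx e0 fL.
  have h1 := trig_approx_Rintegral mX X2 (ltW e0) tQ mfX fQ.
  have h2 := trig_approx_Rintegral mY Y2 (ltW e0) tQ mfY fQ.
  rewrite (cramer_wold_trig tQ) in h1; rewrite distrC in h2.
  apply: le_trans (ler_distD (\int[P2]_w Q (vec Y w)) _ _) _.
  by rewrite mulrDr; exact: lerD.
rewrite leNgt; apply/negP => z0.
have SS : 0 < S1 + S2 + 1 by lra.
have := H (z / (2 * (S1 + S2 + 1))).
rewrite divr_gt0 ?mulr_gt0// => /(_ isT); apply/negP; rewrite -ltNge.
rewrite mulrAC ltr_pdivrMr ?mulr_gt0//; nra.
Qed.

End CramerWold.

(** * Rotation invariance of a pair of independent copies *)

Section GaussianPair.
Context (R : realType) d (T : measurableType d) (P : probability T R).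
Notation mu := (@lebesgue_measure R).
Definition prod_prob : probability (T * T)%type R := (P \x P)%E.

Lemma ge0_integral_prod_fst (g : T -> \bar R) : measurable_fun setT g ->
  (forall x, 0 <= g x)%E -> (\int[prod_prob]_z g z.1 = \int[P]_x g x)%E.
Proof.
move=> mg g0; rewrite (fubini_tonelli1 (fun z => g z.1))//.
  apply: eq_integral => x _; rewrite /fubini_F/= integral_cst//.
  by rewrite -[RHS]mule1; congr (_ * _)%E; exact: probability_setT.
exact: measurableT_comp.
Qed.

Lemma ge0_integral_prod_snd (g : T -> \bar R) : measurable_fun setT g ->
  (forall x, 0 <= g x)%E -> (\int[prod_prob]_z g z.2 = \int[P]_x g x)%E.
Proof.
move=> mg g0; rewrite (fubini_tonelli2 (fun z => g z.2))//.
  apply: eq_integral => x _; rewrite /fubini_G/= integral_cst//.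
  by rewrite -[RHS]mule1; congr (_ * _)%E; exact: probability_setT.
exact: measurableT_comp.
Qed.

Lemma prod_integrable_fst (g : T -> R) : P.-integrable setT (EFin \o g) ->
  prod_prob.-integrable setT (fun z => (g z.1)%:E).
Proof.
move=> /integrableP[/measurable_EFinP mg goo]; apply/integrableP; split.
  by apply/measurable_EFinP; exact: measurableT_comp.
rewrite (ge0_integral_prod_fst (g := fun x => `|(g x)%:E|%E))//.
by do 2 apply: measurableT_comp => //.
Qed.

Lemma prod_integrable_snd (g : T -> R) : P.-integrable setT (EFin \o g) ->
  prod_prob.-integrable setT (fun z => (g z.2)%:E).
Proof.
move=> /integrableP[/measurable_EFinP mg goo]; apply/integrableP; split.
  by apply/measurable_EFinP; exact: measurableT_comp.
rewrite (ge0_integral_prod_snd (g := fun x => `|(g x)%:E|%E))//.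
by do 2 apply: measurableT_comp => //.
Qed.

Lemma measurable_gauss_int_shift (s : R) (f : R -> R) : continuous f ->
  (forall y, 0 <= f y) ->
  measurable_fun setT (fun x : R => gauss_int (fun y => (f (x + y))%:E) 0 s).
Proof.
move=> cf f0; have mf : measurable_fun setT f by exact: continuous_measurable_fun.
rewrite /gauss_int; case: eqP => _.
  by apply/measurable_EFinP; apply: (measurableT_comp mf); exact: measurable_funD.
apply: (measurable_fun_fubini_tonelli_F (m2 := mu)
  (fun z : R * R => (f (z.1 + z.2))%:E * (normal_pdf 0 s z.2)%:E)%E).
- apply: emeasurable_funM; apply/measurable_EFinP.
    by apply: (measurableT_comp mf); exact: measurable_funD.
  by apply: measurableT_comp; first exact: measurable_normal_pdf.
- by move=> z; apply: mule_ge0; rewrite lee_fin ?f0 ?normal_pdf_ge0.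
Qed.

Lemma gaussian_pair (U V : T -> R) a b (f : R -> R) : 0 <= a -> 0 <= b ->
  measurable_fun setT U -> measurable_fun setT V ->
  (forall A, measurable A -> pushforward P U A = gaussian_law 0 a A) ->
  (forall A, measurable A -> pushforward P V A = gaussian_law 0 b A) ->
  continuous f -> (forall y, 0 <= f y) ->
  (\int[prod_prob]_z (f (U z.1 + V z.2))%:E =
   gauss_int (fun x => (f x)%:E) 0 (Num.sqrt (a ^+ 2 + b ^+ 2)))%E.
Proof.
move=> a0 b0 mU mV lU lV cf f0.
have mf : measurable_fun setT f by exact: continuous_measurable_fun.
rewrite (fubini_tonelli1 (fun z => (f (U z.1 + V z.2))%:E)).
- rewrite -gauss_int_convolution//.
  rewrite -(ge0_integral_gaussian mU lU); last 2 first.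
  + exact: measurable_gauss_int_shift.
  + move=> x; rewrite /gauss_int; case: ifP => _; first by rewrite lee_fin.
    by apply: integral_ge0 => y _; apply: mule_ge0; rewrite lee_fin ?f0 ?normal_pdf_ge0.
  apply: eq_integral => x _; rewrite /fubini_F/=.
  rewrite (ge0_integral_gaussian mV lV (f := fun y => (f (U x + y))%:E)) //.
    by apply/measurable_EFinP; apply: (measurableT_comp mf); exact: measurable_funD.
  by move=> y; rewrite lee_fin.
- apply/measurable_EFinP; apply: (measurableT_comp mf).
  by apply: measurable_funD; apply: measurableT_comp.
- by move=> z; rewrite lee_fin.
Qed.

(** A sum of independent centered Gaussian variables has a law determined by its total variance.
    Adding 1 to [f] makes it nonnegative, as the computation by Tonelli requires. *)
Lemma gaussian_pair_Rintegral (U V U' V' : T -> R) a b a' b' (f : R -> R) :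
  0 <= a -> 0 <= b -> 0 <= a' -> 0 <= b' ->
  measurable_fun setT U -> measurable_fun setT V ->
  measurable_fun setT U' -> measurable_fun setT V' ->
  (forall A, measurable A -> pushforward P U A = gaussian_law 0 a A) ->
  (forall A, measurable A -> pushforward P V A = gaussian_law 0 b A) ->
  (forall A, measurable A -> pushforward P U' A = gaussian_law 0 a' A) ->
  (forall A, measurable A -> pushforward P V' A = gaussian_law 0 b' A) ->
  a ^+ 2 + b ^+ 2 = a' ^+ 2 + b' ^+ 2 ->
  continuous f -> (forall y, `|f y| <= 1) ->
  \int[prod_prob]_z f (U z.1 + V z.2) = \int[prod_prob]_z f (U' z.1 + V' z.2).
Proof.
move=> a0 b0 a0' b0' mU mV mU' mV' lU lV lU' lV' ab cf f1.
have f0 y : 0 <= 1 + f y by have := f1 y; rewrite ler_norml => /andP[]; lra.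
have cg : continuous (fun y : R => 1 + f y).
  by move=> y; apply: cvgD; [exact: cvg_cst|exact: cf].
have mf : measurable_fun setT f by exact: continuous_measurable_fun.
have E : (\int[prod_prob]_z (1 + f (U z.1 + V z.2))%:E =
          \int[prod_prob]_z (1 + f (U' z.1 + V' z.2))%:E)%E.
  rewrite (gaussian_pair a0 b0 mU mV lU lV cg f0).
  by rewrite (gaussian_pair a0' b0' mU' mV' lU' lV' cg f0) ab.
have aux (A B : T -> R) : measurable_fun setT A -> measurable_fun setT B ->
    \int[prod_prob]_z (1 + f (A z.1 + B z.2)) = 1 + \int[prod_prob]_z f (A z.1 + B z.2).
  move=> mA mB; rewrite RintegralD//.
  - by rewrite Rintegral_cst_probability.
  - exact: finite_measure_integrable_cst.
  - apply: (@bounded_integrable _ _ _ _ _ 1) => //.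
    by apply: (measurableT_comp mf); apply: measurable_funD; apply: measurableT_comp.
have := congr1 fine E; rewrite -/(Rintegral _ _ _) -/(Rintegral _ _ _).
by rewrite !aux// => /addrI.
Qed.

End GaussianPair.

(** * Joint law of two rotations of a Gaussian family *)

Section GaussianFamily.
Context (R : realType) d (T : measurableType d) (P : probability T R).
Context (I : finType) (G : I -> T -> R) (Gam : I -> I -> R).
Local Notation PP := (prod_prob P).

Definition quad_form (a : I -> R) := \sum_i \sum_j a i * a j * Gam i j.

Hypothesis mG : forall i, measurable_fun setT (G i).
Hypothesis quad0 : forall a, 0 <= quad_form a.
Hypothesis lawG : forall (a : I -> R) A, measurable A ->
  pushforward P (fun w => \sum_i a i * G i w) A =
  gaussian_law 0 (Num.sqrt (quad_form a)) A.

Lemma quad_formE (a : I -> R) i : quad_form (fun j => (j == i)%:R) = Gam i i.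
Proof.
rewrite /quad_form (bigD1 i)//= [X in _ + X]big1 => [|j /negPf ->].
  rewrite addr0 (bigD1 i)//= [X in _ + X]big1 => [|j /negPf ->].
    by rewrite addr0 eqxx !mul1r.
  by rewrite mulr0 mul0r.
by rewrite big1// => k _; rewrite !mul0r.
Qed.

(** The left-hand side is the variance of a.X_t + b.X_u, one summand for each independent copy; the
    angles survive only through u - t. *)
Lemma quad_form_rotation (a b : I -> R) (t u : R) :
  quad_form (fun i => a i * cos t + b i * cos u) +
  quad_form (fun i => a i * sin t + b i * sin u) =
  quad_form a + quad_form b +
  cos (u - t) * \sum_i \sum_j (a i * b j + b i * a j) * Gam i j.
Proof.
rewrite /quad_form mulr_sumr -!big_split; apply: eq_bigr => i _.
rewrite mulr_sumr -!big_split; apply: eq_bigr => j _ /=.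
rewrite cosB.
have ht := cos2Dsin2 t; have hu := cos2Dsin2 u.
rewrite -[in RHS](mulr1 (a i * a j)) -[in RHS](mulr1 (b i * b j)) -{1}ht -hu.
ring.
Qed.

(** The pair (X_t, X_u) as a single vector indexed by [I + I], so that linear forms in it see the
    joint law. *)
Definition rotated (t u : R) (k : I + I) (z : T * T) : R :=
  match k with
  | inl i => cos t * G i z.1 + sin t * G i z.2
  | inr i => cos u * G i z.1 + sin u * G i z.2
  end.

Lemma measurable_rotated t u k : measurable_fun setT (rotated t u k).
Proof.
case: k => i /=; apply: measurable_funD; apply: measurable_funM => //;
by apply: measurableT_comp.
Qed.

Lemma rotated_lincomb t u (a : I + I -> R) z :
  \sum_k a k * rotated t u k z =
  \sum_i (a (inl i) * cos t + a (inr i) * cos u) * G i z.1 +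
  \sum_i (a (inl i) * sin t + a (inr i) * sin u) * G i z.2.
Proof.
rewrite big_sumType/= -!big_split; apply: eq_bigr => i _ /=; ring.
Qed.

Lemma gaussian_family_law1 i A : measurable A ->
  pushforward P (G i) A = gaussian_law 0 (Num.sqrt (Gam i i)) A.
Proof.
move=> mA; rewrite -(quad_formE (fun=> 0) i) -lawG//; congr (pushforward P _ A).
apply/funext => w; rewrite (bigD1 i)//= eqxx mul1r big1 ?addr0// => j /negPf ->.
by rewrite mul0r.
Qed.

Lemma rotated_sqr_integrable t u k :
  PP.-integrable setT (fun z => (rotated t u k z ^+ 2)%:E).
Proof.
have H (a b : R) i : PP.-integrable setT (fun z => ((a * G i z.1 + b * G i z.2) ^+ 2)%:E).
  have G2 := gaussian_integrable_sqr (mG i) (gaussian_family_law1 i).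
  have mfst := integrableZl measurableT (2 * a ^+ 2) (prod_integrable_fst G2).
  have msnd := integrableZl measurableT (2 * b ^+ 2) (prod_integrable_snd G2).
  apply: (le_integrable _ _ _ (integrableD measurableT mfst msnd)) => //.
    apply/measurable_EFinP; apply: measurable_funX; apply: measurable_funD;
    by apply: measurable_funM => //; exact: measurableT_comp.
  move=> z _; rewrite /= lee_fin !ger0_norm ?sqr_ge0//.
    have := sqr_ge0 (a * G i z.1 - b * G i z.2); lra.
  by rewrite addr_ge0// mulr_ge0 ?sqr_ge0// mulr_ge0 ?sqr_ge0.
by case: k => i; exact: H.
Qed.

Lemma rotated_law t u t' u' (a : I + I -> R) (f : R -> R) : u - t = u' - t' ->
  continuous f -> (forall y, `|f y| <= 1) ->
  \int[PP]_z f (\sum_k a k * rotated t u k z) =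
  \int[PP]_z f (\sum_k a k * rotated t' u' k z).
Proof.
move=> tu cf f1.
under eq_Rintegral do rewrite rotated_lincomb.
under [RHS]eq_Rintegral do rewrite rotated_lincomb.
have mlin (b : I -> R) : measurable_fun setT (fun w => \sum_i b i * G i w).
  exact: measurable_lincomb.
apply: (gaussian_pair_Rintegral (sqrtr_ge0 _) (sqrtr_ge0 _) (sqrtr_ge0 _)
  (sqrtr_ge0 _) (mlin _) (mlin _) (mlin _) (mlin _) (@lawG _) (@lawG _)
  (@lawG _) (@lawG _)) => //.
by rewrite !sqr_sqrtr// !quad_form_rotation tu.
Qed.

Lemma rotated_Rintegral t u t' u' (f : (I + I -> R) -> R) L : u - t = u' - t' ->
  (forall z y, `|f z - f y| <= L * \sum_i `|z i - y i|) ->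
  measurable_fun setT (f \o vec (rotated t u)) ->
  measurable_fun setT (f \o vec (rotated t' u')) ->
  \int[PP]_z f (vec (rotated t u) z) = \int[PP]_z f (vec (rotated t' u') z).
Proof.
move=> tu fL mf mf'.
apply: (cramer_wold (measurable_rotated t u) (measurable_rotated t' u')
  (rotated_sqr_integrable t u) (rotated_sqr_integrable t' u') _ _ fL) => //.
- move=> a; apply: rotated_law => //; first exact: continuous_cos.
  by move=> y; rewrite ler_norml cos_geN1 cos_le1.
- move=> a; apply: rotated_law => //; first exact: continuous_sin.
  by move=> y; rewrite ler_norml sin_geN1 sin_le1.
Qed.

End GaussianFamily.

(** * Concentration of finite maxima *)

Section MaxAffine.
Context (R : realType) (I : finType).
Variables (i0 : I) (c : I -> R).
Implicit Types x y : I -> R.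

(** The default is one of the terms, so it does not alter the maximum. *)
Definition max_affine x : R := \big[Num.max/x i0 - c i0]_i (x i - c i).

Lemma max_affine_ge x i : x i - c i <= max_affine x.
Proof. exact: le_bigmax. Qed.

Lemma max_affine_attained x : exists i, max_affine x = x i - c i.
Proof.
rewrite /max_affine; elim/big_ind: _ => [|a b [i ->] [j ->]|i _].
- by exists i0.
- by rewrite /Order.max; case: ifP => _; [exists j|exists i].
- by exists i.
Qed.

Lemma max_affine_lipschitz x y :
  `|max_affine x - max_affine y| <= \sum_i `|x i - y i|.
Proof.
have H u v : max_affine u - max_affine v <= \sum_i `|u i - v i|.
  have [i ->] := max_affine_attained u; have := max_affine_ge v i.
  have : u i - v i <= \sum_j `|u j - v j|.
    rewrite (bigD1 i)//= (le_trans (ler_norm _))// lerDl.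
    exact: sumr_ge0.
  lra.
rewrite ler_norml; apply/andP; split; last exact: H.
rewrite lerNl opprB; apply: le_trans (H _ _) _.
by under eq_bigr do rewrite distrC.
Qed.

Lemma measurable_max_affine d (T : measurableType d) (X : I -> T -> R) :
  (forall i, measurable_fun setT (X i)) ->
  measurable_fun setT (fun w => max_affine (fun i => X i w)).
Proof.
move=> mX; rewrite /max_affine; elim: (index_enum I) => [|i s IH].
  by under eq_fun do rewrite big_nil; exact: measurable_funB.
under eq_fun do rewrite big_cons.
apply: measurable_maxr => //; exact: measurable_funB.
Qed.

End MaxAffine.

(** * Elementary inequalities and truncated exponentials *)

Section ExpR.
Context (R : realType).
Implicit Types (a b m e g : R).

Lemma expR_lipschitz a b m : a <= m -> b <= m ->
  `|expR a - expR b| <= expR m * `|a - b|.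
Proof.
wlog ab : a b / a <= b => [H am bm|].
  have [ab|/ltW ab] := leP a b; first exact: H.
  by rewrite distrC [`|a - b|]distrC; exact: H.
move=> am bm; rewrite distrC [`|a - b|]distrC !ger0_norm ?subr_ge0 ?ler_expR//.
have h := expR_ge1Dx (a - b).
have -> : expR b - expR a = expR b * (1 - expR (a - b)).
  by rewrite mulrBr mulr1 -expRD; congr (_ - expR _); ring.
apply: ler_pM => //.
- by rewrite subr_ge0 expR_le1; lra.
- by rewrite ler_expR.
- lra.
Qed.

(** The tangent line at e g lies below the exponential at 0 and at g; the two inequalities are
    averaged with weights 1 - e and e. *)
Lemma expR_convex_ub e g : 0 <= e <= 1 -> expR (e * g) <= 1 - e + e * expR g.
Proof.
move=> /andP[e0 e1].
have h1 := expR_ge1Dx (- (e * g)); have h2 := expR_ge1Dx ((1 - e) * g).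
have h0 := expR_ge0 (e * g).
have E1 : expR (e * g) * expR (- (e * g)) = 1 by rewrite -expRD subrr expR0.
have E2 : expR (e * g) * expR ((1 - e) * g) = expR g by rewrite -expRD; congr expR; ring.
have := ler_wpM2l h0 h1; have := ler_wpM2l h0 h2; rewrite E1 E2 => k2 k1.
have e1' : 0 <= 1 - e by lra.
have := ler_wpM2l e0 k2; have := ler_wpM2l e1' k1; lra.
Qed.

Lemma expR_sum_convex (K : nat) (a : nat -> R) : (0 < K)%N ->
  expR (K%:R^-1 * \sum_(k < K) a k) <= K%:R^-1 * \sum_(k < K) expR (a k).
Proof.
move=> K0; set m := (_ * \sum_(k < K) a k).
have K0' : 0 < K%:R :> R by rewrite ltr0n.
rewrite mulrC ler_pdivlMr//.
(* The tangent line at the mean: its linear terms sum to 0. *)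
have -> : expR m * K%:R = \sum_(k < K) expR m * (1 + (a k - m)).
  rewrite -mulr_sumr big_split/= sumrB !sumr_const card_ord.
  rewrite -[m *+ K]mulr_natr /m mulrAC mulVf ?gt_eqF// mul1r subrr addr0.
  by [].
apply: ler_sum => k _.
have -> : expR (a k) = expR m * expR (a k - m) by rewrite -expRD; congr expR; ring.
by rewrite ler_wpM2l ?expR_ge0// expR_ge1Dx.
Qed.

Lemma ler_dist_minr a b m : `|Num.min a m - Num.min b m| <= `|a - b|.
Proof.
wlog ab : a b / a <= b => [H|].
  have [ab|/ltW ab] := leP a b; first exact: H.
  by rewrite distrC [`|a - b|]distrC; exact: H.
rewrite distrC [`|a - b|]distrC [leRHS]ger0_norm ?subr_ge0//.
rewrite ger0_norm; last by rewrite subr_ge0 le_min2.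
by have [] := leP a m; have [] := leP b m; lra.
Qed.

Lemma sqr_sin_le (x : R) : sin x ^+ 2 <= x ^+ 2.
Proof.
rewrite -[leLHS]real_normK ?num_real// -[leRHS]real_normK ?num_real//.
by rewrite lerXn2r ?nnegrE// ler_norm_sin.
Qed.

Lemma one_sub_cos_le (x : R) : 1 - cos x <= x ^+ 2.
Proof.
have E : x = (x / 2) *+ 2 by rewrite -mulr_natr divfK.
rewrite {1}E cos_mulr2n.
have t := cos2Dsin2 (x / 2); have := sqr_sin_le (x / 2).
have -> : (x / 2) ^+ 2 = x ^+ 2 / 4 by field.
have := sqr_ge0 x; lra.
Qed.

Lemma integral_expR_trunc d (T : measurableType d) (mu : {measure set T -> \bar R})
    (g : T -> R) : measurable_fun setT g ->
  (\int[mu]_w (expR (Num.min (g w) n%:R))%:E @[n --> \oo] -->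
   \int[mu]_w (expR (g w))%:E)%E.
Proof.
move=> mg.
rewrite (_ : (\int[mu]_w (expR (g w))%:E =
    \int[mu]_w (limn (fun n => (expR (Num.min (g w) n%:R))%:E)))%E).
  apply: cvg_monotone_convergence => //.
  - move=> n; apply/measurable_EFinP; apply: measurableT_comp => //.
    exact: measurable_minr.
  - move=> w _ n m nm; rewrite lee_fin ler_expR le_min2//.
    by rewrite ler_nat.
apply: eq_integral => w _; apply/esym/cvg_lim => //.
apply: (@cvg_near_cst _ _ _ _ _).
exists (Num.bound `|g w|) => //= n /= hn.
rewrite min_l//; apply: le_trans (ler_norm _) _.
apply: ltW; apply: lt_le_trans (archi_boundP (normr_ge0 _)) _.
by rewrite ler_nat.
Qed.

End ExpR.

(** * Exponential moments and tails of the maximum *)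

Section MaureyPisier.
Context (R : realType) d (T : measurableType d) (P : probability T R).
Context (I : finType) (G : I -> T -> R) (Gam : I -> I -> R) (i0 : I) (c : I -> R).
Variable v : R.
Local Notation PP := (prod_prob P).
Local Notation quad_form := (quad_form Gam).
Local Notation rotated := (rotated G).
Hypothesis mG : forall i, measurable_fun setT (G i).
Hypothesis quad0 : forall a, 0 <= quad_form a.
Hypothesis lawG : forall (a : I -> R) A, measurable A ->
  pushforward P (fun w => \sum_i a i * G i w) A =
  gaussian_law 0 (Num.sqrt (quad_form a)) A.
Hypothesis Gamv : forall i, Gam i i <= v.

Let F (x : I -> R) := max_affine i0 c x.
Let M (w : T) := F (fun i => G i w).
Let D (t u : R) (z : T * T) :=
  F (fun i => rotated t u (inl i) z) - F (fun i => rotated t u (inr i) z).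

Let Gam0 i : 0 <= Gam i i.
Proof. by rewrite -(quad_formE Gam (fun=> 0) i). Qed.

Let mgfG i t : (\int[P]_w (expR (t * G i w))%:E = (expR (t ^+ 2 * Gam i i / 2))%:E)%E.
Proof.
rewrite (gaussian_mgf (mG i) (gaussian_family_law1 lawG i)).
by rewrite mulr0 add0r sqr_sqrtr.
Qed.

Let mM : measurable_fun setT M.
Proof. exact: measurable_max_affine. Qed.

Let mD t u : measurable_fun setT (D t u).
Proof.
by apply: measurable_funB; apply: measurable_max_affine => i; exact: measurable_rotated.
Qed.

(* Truncating the exponent makes the integrand Lipschitz, as [cramer_wold] requires. *)
Lemma integral_rotated_expR (k t u t' u' : R) : 0 <= k -> u - t = u' - t' ->
  (\int[PP]_z (expR (k * D t u z))%:E = \int[PP]_z (expR (k * D t' u' z))%:E)%E.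
Proof.
move=> k0 tu.
pose f n (x : I + I -> R) := expR (Num.min
  (k * (F (fun i => x (inl i)) - F (fun i => x (inr i)))) n%:R).
have mf n t0 u0 : measurable_fun setT (f n \o vec (rotated t0 u0)).
  apply: measurableT_comp => //; apply: measurable_minr => //.
  exact: (measurable_funM (measurable_cst k) (mD t0 u0)).
have fb n t0 u0 : PP.-integrable setT (EFin \o (f n \o vec (rotated t0 u0))).
  apply: (@bounded_integrable _ _ _ _ _ (expR n%:R)) => // z.
  by rewrite ger0_norm ?expR_ge0// ler_expR ge_min lexx orbT.
have H n : (\int[PP]_z (f n (vec (rotated t u) z))%:E =
            \int[PP]_z (f n (vec (rotated t' u') z))%:E)%E.
  rewrite -[LHS]fineK; last exact: (integrable_fin_num measurableT (fb n t u)).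
  rewrite -[RHS]fineK; last exact: (integrable_fin_num measurableT (fb n t' u')).
  apply: (f_equal EFin).
  apply: (rotated_Rintegral mG quad0 lawG (L := expR n%:R * k)) => // x y.
  apply: (le_trans (expR_lipschitz (m := n%:R) _ _)).
  - by rewrite ge_min lexx orbT.
  - by rewrite ge_min lexx orbT.
  rewrite -mulrA ler_wpM2l ?expR_ge0//.
  apply: (@le_trans _ _ (k * `|(F (fun i => x (inl i)) - F (fun i => x (inr i))) -
      (F (fun i => y (inl i)) - F (fun i => y (inr i)))|)).
    set A := _ - F (fun i => x (inr i)); set B := _ - F (fun i => y (inr i)).
    have := ler_dist_minr (k * A) (k * B) n%:R.
    by rewrite -mulrBr normrM (ger0_norm k0).
  rewrite ler_wpM2l// big_sumType/=.
  have h1 := max_affine_lipschitz i0 c (fun i => x (inl i)) (fun i => y (inl i)).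
  have h2 := max_affine_lipschitz i0 c (fun i => x (inr i)) (fun i => y (inr i)).
  apply: le_trans (lerD h1 h2); rewrite -/F.
  rewrite (_ : _ - _ - _ = (F (fun i => x (inl i)) - F (fun i => y (inl i))) -
    (F (fun i => x (inr i)) - F (fun i => y (inr i)))); last by ring.
  exact: ler_normB.
have h1 := @integral_expR_trunc _ _ _ PP (fun z => k * D t u z)
  (measurable_funM (measurable_cst k) (mD t u)).
have h2 := @integral_expR_trunc _ _ _ PP (fun z => k * D t' u' z)
  (measurable_funM (measurable_cst k) (mD t' u')).
have E : (fun n : nat => \int[PP]_w (expR (Num.min (k * D t u w) n%:R))%:E)%E =
         (fun n : nat => \int[PP]_w (expR (Num.min (k * D t' u' w) n%:R))%:E)%E.
  by apply/funext => n; exact: H.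
rewrite E in h1; exact: (cvg_unique (@ereal_hausdorff R) h1 h2).
Qed.

Let pi_gt0 : 0 < pi :> R. Proof. exact: pi_gt0. Qed.

Lemma rotated_step (l : R) (K : nat) : 0 < l -> l * pi ^+ 2 <= 4 * K%:R -> (0 < K)%N ->
  (\int[PP]_z (expR (l * K%:R * D 0 (pi / (2 * K%:R)) z))%:E <=
   (expR (l ^+ 2 * pi ^+ 2 * v / 8) *
     (1 + l * pi ^+ 2 / (4 * K%:R) * (#|I|%:R * expR (v / 2))))%:E)%E.
Proof.
move=> l0 lK K0; set k := l * K%:R; set dl := pi / _.
have K0' : 0 < K%:R :> R by rewrite ltr0n.
have k0 : 0 < k by rewrite mulr_gt0.
set e := k * (1 - cos dl).
have e0 : 0 <= e by rewrite mulr_ge0 ?subr_ge0 ?cos_le1// ltW.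
have ele : e <= l * pi ^+ 2 / (4 * K%:R).
  apply: le_trans (ler_wpM2l (ltW k0) (one_sub_cos_le dl)) _.
  rewrite le_eqVlt; apply/orP; left; apply/eqP.
  by rewrite /k /dl; field; rewrite gt_eqF.
(* Needed to bound exp(e g) by its chord 1 - e + e exp(g). *)
have e1 : e <= 1.
  by apply: le_trans ele _; rewrite ler_pdivrMr ?mulr_gt0// mul1r.
have ks : (k * sin dl) ^+ 2 <= l ^+ 2 * pi ^+ 2 / 4.
  have -> : l ^+ 2 * pi ^+ 2 / 4 = (k * dl) ^+ 2.
    by rewrite /k /dl; field; rewrite gt_eqF.
  by rewrite [leLHS]exprMn [leRHS]exprMn ler_wpM2l ?sqr_ge0// sqr_sin_le.
rewrite (fubini_tonelli1 (fun z => (expR (k * D 0 dl z))%:E)); last 2 first.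
- apply/measurable_EFinP; apply: measurableT_comp => //.
  by apply: measurable_funM => //; exact: mD.
- by move=> z; rewrite lee_fin expR_ge0.
set C := expR (l ^+ 2 * _ * _ / 8).
(* [x] is frozen: [j] attains the maximum at [G x] and is a competitor after the
   rotation, which leaves only the Gaussian variable [G j y] to integrate. *)
have inner x : (fubini_F P (fun z => (expR (k * D 0 dl z))%:E) x <=
    (C * (1 + e * \sum_i expR (G i x)))%:E)%E.
  rewrite /fubini_F.
  have [j Fj] := max_affine_attained i0 c (fun i => G i x).
  apply: (@le_trans _ _ (\int[P]_y (expR (e * G j x) *
      expR (- (k * sin dl) * G j y))%:E)%E).
    apply: ge0_le_integral => //.
    - apply/measurable_EFinP; apply: measurableT_comp => //.
      apply: measurable_funM => //; apply: (measurableT_comp (mD 0 dl)).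
      exact: pair1_measurable.
    - apply/measurable_EFinP; apply: measurable_funM => //.
      by apply: measurableT_comp => //; exact: measurable_funM.
    move=> y _; rewrite lee_fin -expRD ler_expR.
    rewrite /D /rotated cos0 sin0.
    under [X in F X - _]eq_fun do rewrite mul1r mul0r addr0.
    rewrite /F Fj.
    have := max_affine_ge i0 c (fun i => cos dl * G i x + sin dl * G i y) j.
    set A := max_affine _ _ _ => h.
    apply: (@le_trans _ _ (k * (G j x - c j - (cos dl * G j x + sin dl * G j y - c j)))).
      by rewrite ler_wpM2l ?(ltW k0)//; lra.
    by rewrite le_eqVlt; apply/orP; left; apply/eqP; rewrite /e; ring.
  under eq_integral do rewrite EFinM.
  rewrite ge0_integralZl//; last first.
    by apply/measurable_EFinP; apply: measurableT_comp => //; exact: measurable_funM.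
  rewrite mgfG -EFinM lee_fin mulrC sqrrN.
  apply: ler_pM; rewrite ?expR_ge0//.
    rewrite ler_expR ler_pdivrMr//.
    have h1 := Gamv j; have h0 := Gam0 j.
    apply: (@le_trans _ _ (l ^+ 2 * pi ^+ 2 / 4 * v)); last lra.
    by apply: ler_pM => //; exact: sqr_ge0.
  apply: (le_trans (expR_convex_ub _ _)); first by rewrite e0.
  (* The index [j] depends on [x]; summing over all indices removes this dependence before
     integrating in [x]. *)
  have : expR (G j x) <= \sum_i expR (G i x).
    by rewrite (bigD1 j)//= lerDl sumr_ge0// => i _; exact: expR_ge0.
  move=> /(ler_wpM2l e0); lra.
apply: (@le_trans _ _ (\int[P]_x (C * (1 + e * \sum_i expR (G i x)))%:E)%E).
  apply: ge0_le_integral => //.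
  - by move=> x _; apply: integral_ge0 => y _; rewrite lee_fin expR_ge0.
  - apply: measurable_fun_fubini_tonelli_F.
      apply/measurable_EFinP; apply: measurableT_comp => //.
      by apply: measurable_funM => //; exact: mD.
    by move=> z; rewrite lee_fin expR_ge0.
  - apply/measurable_EFinP; apply: measurable_funM => //; apply: measurable_funD => //.
    apply: measurable_funM => //; apply: measurable_sum => i.
    exact: measurableT_comp.
have iexp i : P.-integrable setT (fun w => (expR (G i w))%:E).
  apply/integrableP; split; first by apply/measurable_EFinP; exact: measurableT_comp.
  under eq_integral do rewrite /= ger0_norm ?expR_ge0// -[G i _]mul1r.
  by rewrite mgfG ltry.
under eq_integral do rewrite EFinM EFinD EFinM -sumEFin.
rewrite integralZl//; last first.
  apply: integrableD => //; first exact: finite_measure_integrable_cst.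
  by apply: integrableZl => //; apply: integrable_sum.
rewrite integralD//; last 2 first.
- exact: finite_measure_integrable_cst.
- by apply: integrableZl => //; apply: integrable_sum.
rewrite integralZl//; last exact: integrable_sum.
rewrite integral_sum//.
have -> : (\int[P]__ 1%:E = 1%:E)%E.
  by have := expectation_cst P 1; rewrite unlock.
have -> : (\sum_i \int[P]_x (expR (G i x))%:E = (\sum_i expR (Gam i i / 2))%:E)%E.
  rewrite -sumEFin; apply: eq_bigr => i _.
  under eq_integral do rewrite -[G i _]mul1r.
  by rewrite mgfG expr1n mul1r.
apply: (@le_trans _ _ (C * (1 + e * \sum_i expR (Gam i i / 2)))%:E).
  by rewrite EFinM EFinD EFinM.
rewrite lee_fin ler_wpM2l ?expR_ge0// lerD2l.
apply: ler_pM => //; first by apply: sumr_ge0 => i _; exact: expR_ge0.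
rewrite mulr_natl -sumr_const; apply: ler_sum => i _.
rewrite ler_expR ler_pM2r//.
Qed.

Lemma maurey_pisier (l : R) : 0 < l ->
  (\int[PP]_z (expR (l * (M z.1 - M z.2)))%:E <=
   (expR (l ^+ 2 * pi ^+ 2 * v / 8))%:E)%E.
Proof.
move=> l0; set C := expR (l ^+ 2 * _ * _ / 8).
have C0 : 0 < C by exact: expR_gt0.
set B := #|I|%:R * expR (v / 2).
have B0 : 0 <= B by rewrite mulr_ge0// expR_ge0.
have H (K : nat) : (0 < K)%N -> l * pi ^+ 2 <= 4 * K%:R ->
    (\int[PP]_z (expR (l * (M z.1 - M z.2)))%:E <=
     (C * (1 + l * pi ^+ 2 / (4 * K%:R) * B))%:E)%E.
  move=> K0 lK; have K0' : 0 < K%:R :> R by rewrite ltr0n.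
  pose dl : R := pi / (2 * K%:R).
  pose th (k : nat) : R := k%:R * dl.
  (* The sum telescopes, and the angles 0 and pi / 2 give back the two copies themselves. *)
  have DE z : M z.1 - M z.2 = \sum_(k < K) D (th k) (th k.+1) z.
    pose m k := F (fun i => cos (th k) * G i z.1 + sin (th k) * G i z.2).
    rewrite (eq_bigr (fun k : 'I_K => m k - m k.+1))//.
    rewrite -(big_mkord xpredT (fun k => m k - m k.+1)).
    under eq_bigr do rewrite -opprB.
    rewrite sumrN telescope_sumr// opprB /m /th mul0r cos0 sin0.
    have -> : K%:R * dl = pi / 2 by rewrite /dl; field; rewrite gt_eqF.
    rewrite cos_pihalf sin_pihalf /M; congr (F _ - F _); apply/funext => i.
      by rewrite mul1r mul0r addr0.
    by rewrite mul1r mul0r add0r.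
  apply: (@le_trans _ _ (\int[PP]_z (K%:R^-1 * \sum_(k < K)
      expR (l * K%:R * D (th k) (th k.+1) z))%:E)%E).
    apply: ge0_le_integral => //.
    - apply/measurable_EFinP; apply: measurableT_comp => //.
      by apply: measurable_funM => //; apply: measurable_funB; apply: measurableT_comp.
    - apply/measurable_EFinP; apply: measurable_funM => //; apply: measurable_sum => k.
      apply: measurableT_comp => //.
      exact: (measurable_funM (measurable_cst _) (mD (th k) (th k.+1))).
    move=> z _; rewrite lee_fin DE.
    apply: le_trans (@expR_sum_convex _ K (fun k => l * K%:R * D (th k) (th k.+1) z) K0).
    rewrite ler_expR -mulr_sumr mulrA mulrCA mulVf ?gt_eqF// mulr1.
    exact: lexx.
  under eq_integral do rewrite EFinM -sumEFin.
  have mexp k : measurable_fun setT (fun z => (expR (l * K%:R * D (th k) (th k.+1) z))%:E).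
    apply/measurable_EFinP; apply: measurableT_comp => //.
    exact: (measurable_funM (measurable_cst _) (mD (th k) (th k.+1))).
  rewrite ge0_integralZl//; last 2 first.
  - exact: emeasurable_sum.
  - by move=> z _; apply: sume_ge0 => k _; rewrite lee_fin expR_ge0.
  rewrite ge0_integral_sum//.
  (* All steps turn by the same angle, so rotation invariance moves each of them to start at angle
     0. *)
  have step k : (\int[PP]_z (expR (l * K%:R * D (th k) (th k.+1) z))%:E <=
      (C * (1 + l * pi ^+ 2 / (4 * K%:R) * B))%:E)%E.
    rewrite (integral_rotated_expR (t' := 0) (u' := dl)).
    - exact: rotated_step.
    - by rewrite mulr_ge0 ?ltW.
    - by rewrite /th -natr1 mulrDl mul1r addrAC subrr add0r subr0.
  apply: (@le_trans _ _ (K%:R^-1%:E *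
      (\sum_(k < K) (C * (1 + l * pi ^+ 2 / (4 * K%:R) * B))%:E))%E).
    by apply: lee_wpmul2l; [rewrite lee_fin invr_ge0|apply: lee_sum => k _; exact: step].
  rewrite sumEFin -EFinM lee_fin sumr_const card_ord -[X in _ * X <= _]mulr_natr.
  by rewrite mulrCA mulVf ?gt_eqF// mulr1.
apply/lee_addgt0Pr => e e0.
have l1 : 0 <= l * pi ^+ 2 by rewrite mulr_ge0 ?sqr_ge0 ?(ltW l0).
have l2 : 0 <= C * (l * pi ^+ 2 * B) / e.
  apply: divr_ge0; last exact: ltW.
  by apply: mulr_ge0; [exact: ltW|exact: mulr_ge0].
(* The first summand meets the condition on K in [H], the second makes the correction at most e. *)
pose K := (Num.bound (l * pi ^+ 2 + C * (l * pi ^+ 2 * B) / e)).+1.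
have hK : l * pi ^+ 2 + C * (l * pi ^+ 2 * B) / e <= K%:R.
  rewrite ltW//; apply: lt_trans (archi_boundP _) _; last by rewrite ltr_nat.
  exact: addr_ge0.
have K0 : 0 < K%:R :> R by rewrite ltr0n.
apply: (le_trans (H K _ _)) => //; first lra.
rewrite -EFinD lee_fin mulrDr mulr1 lerD2l.
rewrite (_ : C * _ = C * (l * pi ^+ 2 * B) / (4 * K%:R)); last by field; rewrite gt_eqF.
rewrite ler_pdivrMr ?mulr_gt0//.
have : C * (l * pi ^+ 2 * B) / e <= K%:R by lra.
rewrite ler_pdivrMr//; nra.
Qed.

Lemma integrable_max : P.-integrable setT (EFin \o M).
Proof.
have iG i : P.-integrable setT (EFin \o G i).
  exact: (gaussian_integrable (mG i) (gaussian_family_law1 lawG i)).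
apply: (@le_integrable _ _ _ P _ measurableT _ (fun w => \sum_i (`|G i w| + `|c i|)%:E)%E).
- exact/measurable_EFinP.
- move=> w _; rewrite /= sumEFin /= lee_fin.
  rewrite [leRHS]ger0_norm; last by apply: sumr_ge0 => i _; rewrite addr_ge0.
  have [j Mj] := max_affine_attained i0 c (fun i => G i w).
  rewrite /M /F Mj (bigD1 j)//= (le_trans (ler_normB _ _))// lerDl.
  by apply: sumr_ge0 => i _; rewrite addr_ge0.
- apply: integrable_sum => // i _.
  apply: (eq_integrable measurableT (fun w => `|(G i w)%:E| + (`|c i|)%:E)%E) => //.
  apply: integrableD => //; last exact: finite_measure_integrable_cst.
  exact: integrable_abse (iG i).
Qed.

Let m := \int[P]_w M w.

(** Jensen's inequality, by integrating 1 + s (M - m); when the exponential moment is infinite there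
    is nothing to prove. *)
Let exp_moment_ge1 (s : R) : (1 <= \int[P]_w (expR (s * (M w - m)))%:E)%E.
Proof.
have iM := integrable_max.
have iMm : P.-integrable setT (fun w => (M w - m)%:E).
  apply: (eq_integrable measurableT (fun w => (M w)%:E - m%:E)%E) => //.
  by apply: integrableB => //; exact: finite_measure_integrable_cst.
have isMm : P.-integrable setT (fun w => (1 + s * (M w - m))%:E).
  apply: (eq_integrable measurableT (fun w => 1%:E + s%:E * (M w - m)%:E)%E) => //.
  apply: integrableD => //; first exact: finite_measure_integrable_cst.
  exact: integrableZl.
have E : \int[P]_w (1 + s * (M w - m)) = 1.
  rewrite RintegralD//; last 2 first.
  - exact: finite_measure_integrable_cst.
  - exact: (integrableZl measurableT s iMm).
  rewrite RintegralZl// RintegralB//; last exact: finite_measure_integrable_cst.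
  by rewrite !Rintegral_cst_probability subrr mulr0 addr0.
have mexp : measurable_fun setT (fun w => (expR (s * (M w - m)))%:E).
  apply/measurable_EFinP; apply: measurableT_comp => //.
  by apply: measurable_funM => //; exact: measurable_funB.
have [lty|] := ltP (\int[P]_w (expR (s * (M w - m)))%:E)%E +oo%E; last first.
  by rewrite leye_eq => /eqP ->; rewrite leey.
have iexp : P.-integrable setT (fun w => (expR (s * (M w - m)))%:E).
  apply/integrableP; split => //.
  by under eq_integral do rewrite /= ger0_norm ?expR_ge0//.
rewrite -[leRHS]fineK ?lee_fin; last exact: (integrable_fin_num measurableT iexp).
rewrite -[leLHS]E; apply: le_Rintegral => //.
by move=> w _; exact: expR_ge1Dx.
Qed.

Let product_moment (l : R) : 0 < l ->
  (\int[P]_w (expR (l * (M w - m)))%:E * \int[P]_w (expR (- l * (M w - m)))%:E <=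
   (expR (l ^+ 2 * pi ^+ 2 * v / 8))%:E)%E.
Proof.
move=> l0; apply: le_trans (maurey_pisier l0).
have mexp s : measurable_fun setT (fun w => (expR (s * (M w - m)))%:E).
  apply/measurable_EFinP; apply: measurableT_comp => //.
  by apply: measurable_funM => //; exact: measurable_funB.
have e0 s w : (0 <= (expR (s * (M w - m)))%:E)%E by rewrite lee_fin expR_ge0.
rewrite (fubini_tonelli1 (fun z => (expR (l * (M z.1 - M z.2)))%:E)); last 2 first.
- apply/measurable_EFinP; apply: measurableT_comp => //.
  by apply: measurable_funM => //; apply: measurable_funB; apply: measurableT_comp.
- by move=> z; rewrite lee_fin expR_ge0.
rewrite -ge0_integralZr//; last by apply: integral_ge0 => w _; exact: e0.
rewrite le_eqVlt; apply/orP; left; apply/eqP; apply: eq_integral => x _.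
rewrite /fubini_F -ge0_integralZl//.
by apply: eq_integral => y _; rewrite -EFinM -expRD; congr (expR _)%:E; rewrite /=; ring.
Qed.

(** By independence the symmetrized moment is the product of the moments at l and - l. Both factors
    are at least 1, so each is at most the product, and one estimate serves both tails. *)
Lemma max_mgf (l : R) : 0 < l ->
  (\int[P]_w (expR (l * (M w - m)))%:E <= (expR (l ^+ 2 * pi ^+ 2 * v / 8))%:E)%E /\
  (\int[P]_w (expR (l * (m - M w)))%:E <= (expR (l ^+ 2 * pi ^+ 2 * v / 8))%:E)%E.
Proof.
move=> l0; have H := product_moment l0.
have e0 s : (0 <= \int[P]_w (expR (s * (M w - m)))%:E)%E.
  by apply: integral_ge0 => w _; rewrite lee_fin expR_ge0.
split; apply: le_trans H.
  by rewrite -[leLHS]mule1 lee_wpmul2l// exp_moment_ge1.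
have -> : (\int[P]_w (expR (l * (m - M w)))%:E = \int[P]_w (expR (- l * (M w - m)))%:E)%E.
  by apply: eq_integral => w _; rewrite mulNr -mulrN opprB.
by rewrite -[leLHS]mul1e lee_wpmul2r// exp_moment_ge1.
Qed.

Let chernoff_tail (X : T -> R) (l b u : R) : 0 < l -> measurable_fun setT X ->
  (\int[P]_w (expR (l * X w))%:E <= (expR b)%:E)%E ->
  (P [set w | (u < X w)%R] <= (expR (b - l * u))%:E)%E.
Proof.
move=> l0 mX H.
have mA : measurable [set w | u < X w].
  rewrite (_ : [set w | u < X w] = X @^-1` `]u, +oo[%classic).
    by rewrite -[X in measurable X]setTI; exact: mX.
  by apply/seteqP; split => w /=; rewrite in_itv/= andbT.
rewrite -[[set w | _]]setIT -(integral_indic P)//.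
apply: (@le_trans _ _ (\int[P]_w ((expR (- (l * u)))%:E * (expR (l * X w))%:E))%E).
  apply: ge0_le_integral => //.
  - by apply/measurable_EFinP; exact: measurable_indic.
  - apply: emeasurable_funM => //; apply/measurable_EFinP.
    by apply: measurableT_comp => //; exact: measurable_funM.
  - move=> w _; rewrite -EFinM lee_fin -expRD indicE.
    case: (boolP (w \in _)) => [|_]; last exact: expR_ge0.
    rewrite inE/= => uX; rewrite -[leLHS]expR0 ler_expR.
    by rewrite addrC subr_ge0 ler_pM2l// ltW.
rewrite ge0_integralZl//; last first.
  by apply/measurable_EFinP; apply: measurableT_comp => //; exact: measurable_funM.
apply: (@le_trans _ _ ((expR (- (l * u)))%:E * (expR b)%:E)%E).
  by apply: lee_wpmul2l.
by rewrite -EFinM lee_fin -expRD addrC.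
Qed.

Lemma max_affine_concentration (u : R) : 0 < v -> 0 < u ->
  (P [set w | (u < `|M w - m|)%R] <= (2 * expR (- (2 / pi ^+ 2 * (u ^+ 2 / v))))%:E)%E.
Proof.
(* The minimizer of l^2 pi^2 v / 8 - l u. *)
move=> v0 u0; pose l := 4 * u / (pi ^+ 2 * v).
have l0 : 0 < l by rewrite divr_gt0 ?mulr_gt0 ?exprn_gt0.
have [h1 h2] := max_mgf l0.
have mB1 : measurable_fun setT (fun w => M w - m) by exact: measurable_funB.
have mB2 : measurable_fun setT (fun w => m - M w) by exact: measurable_funB.
have k1 := chernoff_tail u l0 mB1 h1.
have k2 := chernoff_tail u l0 mB2 h2.
have E : l ^+ 2 * pi ^+ 2 * v / 8 - l * u = - (2 / pi ^+ 2 * (u ^+ 2 / v)).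
  have aux (p : R) : p != 0 -> (4 * u / (p ^+ 2 * v)) ^+ 2 * p ^+ 2 * v / 8 -
      4 * u / (p ^+ 2 * v) * u = - (2 / p ^+ 2 * (u ^+ 2 / v)).
    by move=> p0; field; rewrite p0 gt_eqF.
  by rewrite aux// gt_eqF.
rewrite E in k1 k2.
have mlt (X : T -> R) : measurable_fun setT X -> measurable [set w | u < X w].
  move=> mX; rewrite (_ : [set w | u < X w] = X @^-1` `]u, +oo[%classic).
    by rewrite -[X in measurable X]setTI; exact: mX.
  by apply/seteqP; split => w /=; rewrite in_itv/= andbT.
have -> : [set w | u < `|M w - m|] = [set w | u < M w - m] `|` [set w | u < m - M w].
  apply/seteqP; split => w /=.
    by rewrite lter_normr => /orP[|]; [left|right]; rewrite // -opprB.
  by move=> [|] h; rewrite lter_normr ?h// opprB h orbT.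
apply: (le_trans (measureU2 _ (mlt _ mB1) (mlt _ mB2))).
by rewrite mulr2n mulrDl mul1r EFinD; exact: leeD.
Qed.

End MaureyPisier.

(** * Truncated variation as a countable supremum *)

Section WithinContinuous.
Context (R : realType).
Implicit Types (f : R -> R) (A : set R).

Lemma within_continuous_dist f A (x e : R) : {within A, continuous f} -> A x ->
  0 < e -> exists2 r, 0 < r & forall y, A y -> `|x - y| < r -> `|f x - f y| < e.
Proof.
move=> /subspace_continuousP cf Ax e0; have := cf x Ax.
move=> /cvgrPdist_lt /(_ e e0) /nbhs_ballP[r /= r0 rP].
by exists r => // y Ay xy; apply: rP.
Qed.

(** Heine's theorem, by compactness in its near-covering form, with the filter of small positive
    radii as parameter. *)
Lemma within_unif_continuous f (a b e : R) : {within `[a, b], continuous f} ->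
  0 < e -> exists2 r, 0 < r & forall x y, x \in `[a, b] -> y \in `[a, b] ->
    `|x - y| < r -> `|f x - f y| <= e.
Proof.
move=> cf e0.
pose Q (r x : R) := x \in `[a, b] -> forall y, y \in `[a, b] -> `|x - y| < r ->
  `|f x - f y| <= e.
have /compact_near_coveringP/(_ R (0^'+) Q _) H := @segment_compact R a b.
have [x abx|r /= r0 rP] := H _.
  have e2 : 0 < e / 2 by rewrite divr_gt0.
  have [r r0 rP] := within_continuous_dist cf abx e2.
  exists (ball x (r / 2), [set s | s < r / 2]).
    split; first by apply: nbhsx_ballx; rewrite divr_gt0.
    by apply: nbhs_right_lt; rewrite divr_gt0.
  move=> [z s] /= [xz sr] abz y aby zy.
  have xz2 : `|x - z| < r / 2 := xz.
  have h1 := rP z abz; have h2 := rP y aby.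
  have d1 : `|x - y| < r.
    have := ler_distD z x y; lra.
  have h3 : `|f x - f z| < e / 2 by apply: h1; lra.
  have h4 := h2 d1.
  have := ler_distD (f x) (f z) (f y); rewrite distrC in h3; lra.
exists (r / 2); first by rewrite divr_gt0.
move=> x y abx aby; apply: (rP (r / 2) _ _ x) => //.
- by rewrite /= sub0r normrN gtr0_norm ?divr_gt0// ltr_pdivrMr// ltr_pMr// ltr1n.
- by rewrite divr_gt0.
Qed.

End WithinContinuous.

Section TruncatedVariation.
Context (R : realType).
Implicit Types (f : R -> R) (c S x : R).

(* A configuration lists the chosen intervals [ratr p.1.1, ratr p.1.2], from left
   to right, with the sign (-1)^p.2 given to the increment over the interval. *)
Definition config := seq (rat * rat * bool).
Implicit Types (l : config) (p : rat * rat * bool).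

Definition left_pt p : R := ratr p.1.1.
Definition right_pt p : R := ratr p.1.2.

(** The bound [x] is the last endpoint used, so the tail of a valid configuration is valid from its
    new bound; the empty case places the last endpoint below [S]. *)
Fixpoint config_valid S x l : bool :=
  if l is p :: l' then
    [&& x <= left_pt p, left_pt p < right_pt p & config_valid S (right_pt p) l']
  else x <= S.

Definition config_sum f l : R :=
  \sum_(p <- l) (-1) ^+ p.2 * (f (right_pt p) - f (left_pt p)).

Definition config_val c f l : R := config_sum f l - c * (size l)%:R.

Lemma config_valid_le S x l : config_valid S x l -> x <= S.
Proof.
elim: l x => [//|p l IH] x /= /and3P[h1 h2 /IH h3].
exact: le_trans h1 (le_trans (ltW h2) h3).
Qed.

Lemma config_valid_nth d S x l : config_valid S x l -> (0 < size l)%N ->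
  [/\ x <= left_pt (nth d l 0),
      forall i, (i < size l)%N -> left_pt (nth d l i) < right_pt (nth d l i),
      forall i, (i.+1 < size l)%N -> right_pt (nth d l i) <= left_pt (nth d l i.+1)
    & right_pt (nth d l (size l).-1) <= S].
Proof.
elim: l x => [//|p l IH] x /= /and3P[h1 h2 h3] _.
case: l IH h3 => [_ h3|q l IH h3].
  by split => //; case.
have [k1 k2 k3 k4] := IH _ h3 isT; split => //.
- by move=> [//|i] /k2.
- by move=> [//|i] /k3.
Qed.

Lemma config_val_le_TV c f S l : 0 <= c -> 0 < S -> config_valid S 0 l ->
  ((config_val c f l)%:E <= TV c f S)%E.
Proof.
move=> c0 S0 vl.
have le_max0 (z : R) : 0 <= Num.max z 0 by rewrite le_max lexx orbT.
case: (posnP (size l)) => [/size0nil ->|l0].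
  (* Truncated variation requires at least one interval, so the empty configuration is compared with
     [0, S]. *)
  apply: (@le_trans _ _ (\sum_(i < 1) Num.max (`|f S - f 0| - c) 0)%:E).
    rewrite lee_fin /config_val /config_sum big_nil/= mulr0 subr0.
    exact: sumr_ge0.
  apply: ereal_sup_ubound; exists 1%N, (fun=> 0), (fun=> S); split => //.
pose d : rat * rat * bool := (0, 0, false).
have [k1 k2 k3 k4] := config_valid_nth d vl l0.
apply: (@le_trans _ _ (\sum_(i < size l) Num.max
    (`|f (right_pt (nth d l i)) - f (left_pt (nth d l i))| - c) 0)%:E); last first.
  apply: ereal_sup_ubound; exists (size l), (fun i => left_pt (nth d l i)),
    (fun i => right_pt (nth d l i)); split => //.
rewrite lee_fin /config_val /config_sum (big_nth d) big_mkord.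
have -> : c * (size l)%:R = \sum_(i < size l) c.
  by rewrite sumr_const card_ord mulr_natr.
rewrite -sumrB; apply: ler_sum => i _.
rewrite le_max lerD2r; apply/orP; left; apply: le_trans (ler_norm _) _.
by rewrite normrM normrX normrN1 expr1n mul1r.
Qed.

(** The rational points lie strictly inside ]a, b[, so shrinking intervals in this way preserves
    their order; the midpoint keeps the two points apart. *)
Lemma rat_increment_approx f (a b e : R) : {within `[0, +oo[, continuous f} ->
  0 <= a -> a < b -> 0 < e -> exists q1 q2 : rat,
    [/\ a < ratr q1, (ratr q1 : R) < ratr q2, ratr q2 < b &
        `|(f b - f a) - (f (ratr q2) - f (ratr q1))| <= e].
Proof.
move=> cf a0 ab e0.
have A0 : `[0, +oo[%classic a by rewrite /= in_itv/= andbT.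
have B0 : `[0, +oo[%classic b by rewrite /= in_itv/= andbT (le_trans a0)// ltW.
have e2 : 0 < e / 2 by rewrite divr_gt0.
have [ra ra0 raP] := within_continuous_dist cf A0 e2.
have [rb rb0 rbP] := within_continuous_dist cf B0 e2.
have [am mb] := midf_lt ab; set m := (a + b) / 2 in am mb.
have [q1 ] : exists q : rat, ratr q \in `]a, (Num.min (a + ra) m)[.
  by apply: rat_in_itvoo; rewrite lt_min ltrDl ra0.
have [q2 ] : exists q : rat, ratr q \in `](Num.max (b - rb) m), b[.
  by apply: rat_in_itvoo; rewrite gt_max mb andbT ltrBlDr ltrDl.
rewrite !in_itv/= lt_min gt_max => /andP[/andP[q2r q2m] q2b] /and3P[q1a q1r q1m].
exists q1, q2; split => //; first exact: lt_trans q1m q2m.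
have h1 : `|f a - f (ratr q1)| < e / 2.
  apply: raP; first by rewrite /= in_itv/= andbT (le_trans a0)// ltW.
  by rewrite distrC ger0_norm ?subr_ge0 ?(ltW q1a)// ltrBlDl.
have h2 : `|f b - f (ratr q2)| < e / 2.
  apply: rbP.
    by rewrite /= in_itv/= andbT (le_trans a0)// (le_trans (ltW am))// ltW.
  by rewrite ger0_norm ?subr_ge0 ?(ltW q2b)// ltrBlDl -ltrBlDr.
rewrite (_ : _ - _ = (f b - f (ratr q2)) - (f a - f (ratr q1))); last by ring.
apply: le_trans (ler_normB _ _) _; clear -h1 h2; lra.
Qed.

(** An interval whose increment is at most c in absolute value adds 0 and is dropped, since in a
    configuration it would cost c. Any other is shrunk to rational endpoints, with the sign of its
    increment and half of the error; the rest of the family shares the other half. *)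
Lemma config_approx c f S x n (a b : nat -> R) (e : R) :
  {within `[0, +oo[, continuous f} -> 0 <= c -> 0 <= x -> x <= S -> 0 < e ->
  (forall i, (i < n)%N -> a i < b i) ->
  (forall i, (i.+1 < n)%N -> b i <= a i.+1) ->
  ((0 < n)%N -> x <= a 0%N /\ b n.-1 <= S) ->
  exists2 l, config_valid S x l &
    \sum_(i < n) Num.max (`|f (b i) - f (a i)| - c) 0 <= config_val c f l + e.
Proof.
move=> cf c0; elim: n a b x e => [|n IH] a b x e x0 xS e0 ab ba aS.
  exists [::] => //.
  by rewrite big_ord0 /config_val /config_sum big_nil mulr0 subr0 add0r ltW.
have [xa bS] := aS isT.
have ab0 : a 0%N < b 0%N by exact: ab.
have bS' : forall i, (i <= n)%N -> b i <= S.
  have H k : (k <= n)%N -> b (n - k)%N <= S.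
    elim: k => [|k IHk] kn; first by rewrite subn0.
    apply: le_trans (IHk (ltnW kn)).
    have -> : (n - k = (n - k.+1).+1)%N by rewrite subnSK.
    have h : ((n - k.+1).+1 < n.+1)%N by rewrite ltnS subnSK// leq_subr.
    exact: le_trans (ba _ h) (ltW (ab _ h)).
  by move=> i iN; have := H (n - i)%N; rewrite leq_subr subKn//; apply.
have IH' y e1 : 0 <= y -> y <= b 0%N -> 0 < e1 -> exists2 l, config_valid S y l &
    \sum_(i < n) Num.max (`|f (b i.+1) - f (a i.+1)| - c) 0 <= config_val c f l + e1.
  move=> y0 yb e10; apply: (IH (fun i => a i.+1) (fun i => b i.+1)) => //.
  - exact: le_trans yb (bS' _ _).
  - by move=> i iN; exact: ab.
  - by move=> i iN; exact: ba.
  - move=> n0; split; first exact: le_trans yb (ba _ _).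
    by rewrite /= prednK.
rewrite big_ord_recl.
have [cl|cg] := leP (`|f (b 0%N) - f (a 0%N)| - c) 0.
  have [l vl hl] := IH' x e x0 (ltW (le_lt_trans xa ab0)) e0.
  by exists l => //; rewrite add0r.
have a0 : 0 <= a 0%N by exact: le_trans x0 xa.
have e2 : 0 < e / 2 by rewrite divr_gt0.
have [q1 [q2 [aq qq qb hs]]] := rat_increment_approx cf a0 ab0 e2.
have q20 : 0 <= ratr q2 :> R by exact: le_trans a0 (ltW (lt_trans aq qq)).
have [l vl hl] := IH' (ratr q2) (e / 2) q20 (ltW qb) e2.
pose s := f (b 0%N) - f (a 0%N) < 0.
exists ((q1, q2, s) :: l).
  by rewrite /= /left_pt /right_pt /= vl qq (le_trans xa (ltW aq)).
have {}hs : `|f (b 0%N) - f (a 0%N)| <= (-1) ^+ s * (f (ratr q2) - f (ratr q1)) + e / 2.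
  move: hs; rewrite /s ler_norml => /andP[u1 u2]; clear -u1 u2.
  case: ltP => z; [rewrite ltr0_norm// expr1 | rewrite ger0_norm// expr0]; lra.
move: hl; rewrite /config_val /config_sum big_cons /left_pt /right_pt /=.
rewrite -[(size l).+1%:R]natr1.
set X := \sum_(p <- l) _; set Y := \sum_(i < n) _.
by move=> hl; clear -hl hs; lra.
Qed.

(** Codes without a valid configuration stand for the empty one, and so does index 0; the value 0
    thus occurs in every initial segment and makes all partial maxima nonnegative. *)
Definition config_enum S (n : nat) : config :=
  let l := if n is n'.+1 then odflt [::] (unpickle n' : option config) else [::] in
  if config_valid S 0 l then l else [::].

Lemma config_enum_valid S n : 0 <= S -> config_valid S 0 (config_enum S n).
Proof. by rewrite /config_enum; case: ifP. Qed.

Lemma config_enum_surj S l : config_valid S 0 l -> exists n, config_enum S n = l.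
Proof.
by move=> vl; exists (@pickle config l).+1; rewrite /config_enum pickleK/= vl.
Qed.

Lemma config_enum0 S : config_enum S 0 = [::].
Proof. by rewrite /config_enum; case: ifP. Qed.

Lemma TV_config_sup c f S : {within `[0, +oo[, continuous f} -> 0 <= c -> 0 < S ->
  TV c f S = ereal_sup (range (fun n => (config_val c f (config_enum S n))%:E)).
Proof.
move=> cf c0 S0; apply/eqP; rewrite eq_le; apply/andP; split; last first.
  apply: ge_ereal_sup => _ [n _ <-].
  by apply: config_val_le_TV => //; apply: config_enum_valid; exact: ltW.
apply: ge_ereal_sup => _ [n [a [b [[n0 a0 ab ba bS] ->]]]].
apply/lee_addgt0Pr => e e0.
have [l vl hl] := config_approx cf c0 (lexx 0) (ltW S0) e0 ab ba (fun _ => conj a0 bS).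
apply: (@le_trans _ _ ((config_val c f l)%:E + e%:E)%E).
  by rewrite -EFinD lee_fin.
rewrite leeD2r//; apply: ereal_sup_ubound.
by have [k <-] := config_enum_surj vl; exists k.
Qed.

(** Cut [a, b] into pieces of length r / 2, each contributing at most c. The subtracted c pays for
    the last, incomplete piece, which leaves a bound linear in the length. *)
Lemma unif_continuous_increment f (c r a b S : R) : 0 <= c -> 0 < r ->
  (forall x y, x \in `[0, S] -> y \in `[0, S] -> `|x - y| < r -> `|f x - f y| <= c) ->
  0 <= a -> a <= b -> b <= S -> `|f b - f a| - c <= c * ((b - a) / (r / 2)).
Proof.
move=> c0 r0 fr a0 ab bS.
have r2 : 0 < r / 2 by rewrite divr_gt0.
have H n : forall a, 0 <= a -> a <= b -> b - a < n.+1%:R * (r / 2) ->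
    `|f b - f a| <= c * n.+1%:R.
  elim: n => [|n IH] z z0 zb zr.
    rewrite mulr1; apply: fr; rewrite ?in_itv/=; [lra|lra|rewrite ger0_norm; lra].
  have [h|h] := leP (z + r / 2) b.
    have := IH (z + r / 2); have := fr (z + r / 2) z; rewrite !in_itv/=.
    rewrite addrAC subrr add0r (gtr0_norm r2) => k1 k2.
    have {k1} k1 : `|f (z + r / 2) - f z| <= c by apply: k1; lra.
    have {k2} k2 : `|f b - f (z + r / 2)| <= c * n.+1%:R.
      by apply: k2; [lra|lra|]; move: zr; rewrite -[n.+2%:R]natr1; lra.
    have := ler_distD (f (z + r / 2)) (f b) (f z).
    by rewrite -[n.+2%:R]natr1; lra.
  apply: (@le_trans _ _ c).
    apply: fr; rewrite ?in_itv/=; [lra|lra|rewrite ger0_norm; lra].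
  by rewrite ler_peMr// ler1n.
have t0 : 0 <= (b - a) / (r / 2) by rewrite divr_ge0 ?subr_ge0// ltW.
have /andP[h1 h2] := truncn_itv t0.
rewrite ltr_pdivrMr// in h2; have := H _ a a0 ab h2.
have := ler_wpM2l c0 h1; rewrite -natr1; lra.
Qed.

Lemma TV_lty c f S : {within `[0, +oo[, continuous f} -> 0 < c -> 0 < S ->
  (TV c f S < +oo)%E.
Proof.
move=> cf c0 S0.
have cf' : {within `[0, S], continuous f}.
  apply: continuous_subspaceW cf => x /=; rewrite !in_itv/= => /andP[-> _] //.
have [r r0 rP] := within_unif_continuous cf' c0.
have r2 : 0 < r / 2 by rewrite divr_gt0.
apply: (@le_lt_trans _ _ (c * (S / (r / 2)))%:E); last exact: ltry.
apply: ge_ereal_sup => _ [n [a [b [[n0 a0 ab ba bS] ->]]]]; rewrite lee_fin.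
(* The bound uses the endpoint b k instead of the total length, which absorbs the gaps. *)
have H k : (k < n)%N -> 0 <= a k /\
    (b k <= S -> \sum_(i < k.+1) Num.max (`|f (b i) - f (a i)| - c) 0 <= c * (b k / (r / 2))).
  have step i : 0 <= a i -> (i < n)%N -> b i <= S ->
      Num.max (`|f (b i) - f (a i)| - c) 0 <= c * ((b i - a i) / (r / 2)).
    move=> ai0 iN bi; have abi := ab _ iN; rewrite ge_max; apply/andP; split.
      apply: (unif_continuous_increment (ltW c0) r0 rP) => //; exact: ltW.
    by rewrite mulr_ge0 ?divr_ge0 ?subr_ge0 ?ltW.
  elim: k => [|k IH] kn.
    split => // bS0; rewrite big_ord_recl big_ord0 addr0.
    apply: le_trans (step _ a0 kn bS0) _.
    by rewrite ler_pM2l// ler_pM2r ?invr_gt0//; lra.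
  have [ak0 IHk] := IH (ltnW kn).
  have h1 := ba _ kn; have h2 := ab _ kn; have h3 := ab _ (ltnW kn).
  have ak : 0 <= a k.+1 by lra.
  split => // bkS; rewrite big_ord_recr/=.
  have h4 := step _ ak kn bkS; have h5 : b k <= S by lra.
  have h6 := IHk h5.
  apply: (le_trans (lerD h6 h4)).
  by rewrite -mulrDr ler_pM2l// -mulrDl ler_pM2r ?invr_gt0//; lra.
have n1 : (n.-1 < n)%N by rewrite prednK.
have [_ /(_ bS)] := H _ n1; rewrite prednK// => /le_trans; apply.
by rewrite ler_pM2l// ler_pM2r ?invr_gt0.
Qed.

End TruncatedVariation.

(** * Variance of a signed sum of increments *)

Section IncrementCovariance.
Context (R : realType) (p : R).
Hypothesis p1 : 1 <= p.
Implicit Types (a b x y S : R) (l : config).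

Definition fbm_cov a b : R := 2^-1 * (`|a| `^ p + `|b| `^ p - `|b - a| `^ p).

(** For p = 2 H, the covariance of the increments of fractional Brownian motion over [a, b] and
    [x, y]. *)
Definition inc_cov a b x y : R :=
  fbm_cov b y - fbm_cov b x - fbm_cov a y + fbm_cov a x.

Lemma inc_covE a b x y : inc_cov a b x y =
  2^-1 * (`|y - a| `^ p + `|x - b| `^ p - `|y - b| `^ p - `|x - a| `^ p).
Proof. by rewrite /inc_cov /fbm_cov; lra. Qed.

(** The points u + h and u + k are the convex combinations of u and u + h + k with exchanged
    weights; convexity is applied to both and the results are added. *)
Lemma powR_convex_incr (u h k : R) : 0 <= u -> 0 <= h -> 0 <= k ->
  (u + h) `^ p + (u + k) `^ p <= (u + h + k) `^ p + u `^ p.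
Proof.
move=> u0 h0 k0.
have [hk|hk] := eqVneq (h + k) 0.
  have -> : h = 0 by lra.
  have -> : k = 0 by lra.
  by rewrite !addr0.
have hk0 : 0 < h + k by lra.
have t01 : 0 <= h / (h + k) <= 1.
  apply/andP; split; first by rewrite divr_ge0// ltW.
  by rewrite ler_pdivrMr// mul1r lerDl.
pose t : {i01 R} := Itv01 (andP t01).1 (andP t01).2.
have D (z : R) : 0 <= z -> z \in `[0, +oo[%classic by move=> z0; rewrite inE/= in_itv/= andbT.
have z0 : 0 <= u + h + k by lra.
have H1 : (h / (h + k) * (u + h + k) + (1 - h / (h + k)) * u) `^ p <=
    h / (h + k) * (u + h + k) `^ p + (1 - h / (h + k)) * u `^ p.
  exact: (convex_powR p1 t (D _ z0) (D _ u0)).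
have H2 : (h / (h + k) * u + (1 - h / (h + k)) * (u + h + k)) `^ p <=
    h / (h + k) * u `^ p + (1 - h / (h + k)) * (u + h + k) `^ p.
  exact: (convex_powR p1 t (D _ u0) (D _ z0)).
move: H1 H2.
have -> : h / (h + k) * u + (1 - h / (h + k)) * (u + h + k) = u + k by field.
have -> : h / (h + k) * (u + h + k) + (1 - h / (h + k)) * u = u + h by field.
clear; lra.
Qed.

Lemma inc_cov_ge0 a b x y : a <= b -> b <= x -> x <= y -> 0 <= inc_cov a b x y.
Proof.
move=> ab bx xy; rewrite inc_covE mulr_ge0//.
rewrite !ger0_norm ?subr_ge0 ?(le_trans ab) ?(le_trans bx)//.
have := @powR_convex_incr (x - b) (b - a) (y - x).
rewrite !subr_ge0 => /(_ bx ab xy).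
rewrite (_ : x - b + (b - a) = x - a); last by ring.
rewrite (_ : x - b + (y - x) = y - b); last by ring.
rewrite (_ : x - a + (y - x) = y - a); last by ring.
lra.
Qed.

Lemma inc_cov_catr a b x y z : inc_cov a b x y + inc_cov a b y z = inc_cov a b x z.
Proof. by rewrite /inc_cov; ring. Qed.

Lemma inc_cov_diag a b : 0 <= p -> p != 0 -> inc_cov a b a b = `|b - a| `^ p.
Proof.
move=> p0 pn0; rewrite inc_covE !subrr normr0 powR0// distrC; lra.
Qed.

Definition config_sign (q : rat * rat * bool) : R := (-1) ^+ q.2.

Definition config_cov1 a b l : R :=
  \sum_(q <- l) config_sign q * inc_cov a b (left_pt R q) (right_pt R q).

Definition config_cov l : R :=
  \sum_(q <- l) config_sign q * config_cov1 (left_pt R q) (right_pt R q) l.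

Lemma config_sign_sqr q : config_sign q * config_sign q = 1.
Proof. by rewrite /config_sign -expr2 sqrr_sign. Qed.

Lemma normr_config_sign q : `|config_sign q| = 1.
Proof. by rewrite /config_sign normrX normrN1 expr1n. Qed.

Lemma config_cov1_bound a b S x l : a <= b -> b <= x -> config_valid S x l ->
  `|config_cov1 a b l| <= inc_cov a b x S.
Proof.
move=> ab; elim: l x => [|q l IH] x bx /=.
  by move=> xS; rewrite /config_cov1 big_nil normr0 inc_cov_ge0.
move=> /and3P[h1 h2 h3]; rewrite /config_cov1 big_cons.
have bq : b <= right_pt R q by rewrite (le_trans bx)// (le_trans h1)// ltW.
apply: le_trans (ler_normD _ _) _.
rewrite normrM normr_config_sign mul1r ger0_norm; last first.
  by apply: inc_cov_ge0 => //; [exact: le_trans bx h1|exact: ltW].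
apply: le_trans (lerD (lexx _) (IH _ bq h3)) _.
rewrite inc_cov_catr -(inc_cov_catr a b x (left_pt R q) S) lerDr.
exact: inc_cov_ge0.
Qed.

Lemma fbm_covC a b : fbm_cov a b = fbm_cov b a.
Proof. by rewrite /fbm_cov distrC [`|a| `^ p + _]addrC. Qed.

Lemma inc_covC a b x y : inc_cov a b x y = inc_cov x y a b.
Proof. by rewrite /inc_cov !(fbm_covC _ x) !(fbm_covC _ y); ring. Qed.

Lemma config_cov_cons q l : config_cov (q :: l) =
  inc_cov (left_pt R q) (right_pt R q) (left_pt R q) (right_pt R q) +
  2 * config_sign q * config_cov1 (left_pt R q) (right_pt R q) l + config_cov l.
Proof.
rewrite /config_cov big_cons.
have -> : \sum_(r <- l) config_sign r * config_cov1 (left_pt R r) (right_pt R r) (q :: l) =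
    config_sign q * config_cov1 (left_pt R q) (right_pt R q) l + config_cov l.
  under eq_bigr do rewrite /config_cov1 big_cons mulrDr -/(config_cov1 _ _ l).
  rewrite big_split/= /config_cov1 mulr_sumr; congr (_ + _).
  by apply: eq_bigr => r _; rewrite mulrCA inc_covC.
rewrite {1}/config_cov1 big_cons -/(config_cov1 _ _ l) mulrDr mulrA config_sign_sqr.
by rewrite /config_cov; ring.
Qed.

(** Induction from the right end: if [a, b] is the first interval, the variance over [a, S] splits
    into those over [a, b] and [b, S] and twice their covariance, which bounds the signed cross
    term. Extending [a, S] to [x, S] only increases the variance. *)
Lemma config_cov_bound S x l : config_valid S x l -> config_cov l <= inc_cov x S x S.
Proof.
have p0 : 0 <= p by exact: le_trans ler01 p1.
have pn0 : p != 0 by rewrite gt_eqF// (lt_le_trans ltr01).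
elim: l x => [|q l IH] x /=.
  by move=> xS; rewrite /config_cov big_nil inc_cov_diag// powR_ge0.
move=> /and3P[h1 h2 h3]; rewrite config_cov_cons.
have := IH _ h3.
have := config_cov1_bound (ltW h2) (lexx _) h3.
set a := left_pt R q; set b := right_pt R q => k1 k2.
have bS := config_valid_le h3.
have k3 : 2 * config_sign q * config_cov1 a b l <= 2 * inc_cov a b b S.
  rewrite -mulrA ler_pM2l//; apply: le_trans (ler_norm _) _.
  by rewrite normrM normr_config_sign mul1r.
apply: (@le_trans _ _ (inc_cov a S a S)).
  have -> : inc_cov a S a S = inc_cov a b a b + 2 * inc_cov a b b S + inc_cov b S b S.
    rewrite /inc_cov (fbm_covC S a) (fbm_covC S b) (fbm_covC b a).
    move: (fbm_cov S S) (fbm_cov a S) (fbm_cov a a) => u1 u2 u3.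
    by move: (fbm_cov a b) (fbm_cov b b) (fbm_cov b S) => u4 u5 u6; ring.
  by apply: lerD => //; exact: lerD.
rewrite !inc_cov_diag//.
have aS : a <= S by rewrite (le_trans (ltW h2)).
rewrite !ger0_norm ?subr_ge0 ?(le_trans h1)//.
by rewrite ge0_ler_powR ?nnegrE ?subr_ge0 ?(le_trans h1)//; lra.
Qed.

End IncrementCovariance.

(** * Linear functionals of fractional Brownian motion *)

Section GaussianFunctionals.
Context (R : realType) d (T : measurableType d) (P : probability T R).
Context (H : R) (W : R -> {RV P >-> R}).
Hypothesis fbmW : fractional_brownian_motion P H W.
Local Notation cov := (fbm_cov (2 * H)).
Implicit Types (L : seq (R * R)) (q : R * R).

Definition lin L (w : T) : R := \sum_(q <- L) q.1 * W q.2 w.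
Definition nneg_times L : bool := all (fun q => 0 <= q.2) L.
Definition lin_cov L L' : R :=
  \sum_(q <- L) \sum_(r <- L') q.1 * r.1 * cov q.2 r.2.

Lemma measurable_lin L : measurable_fun setT (lin L).
Proof. by apply: measurable_sum => q; apply: measurable_funM. Qed.

Lemma lin_gaussian L : nneg_times L -> exists m s : R, 0 <= s /\
  forall A, measurable A -> pushforward P (lin L) A = gaussian_law m s A.
Proof.
move=> /allP L0; have [_ gW _ _ _] := fbmW.
have [|m [s [s0 lawE]]] := gW (size L) (fun i => (nth (0, 0) L i).2)
  (fun i => (nth (0, 0) L i).1).
  by move=> i; apply: L0; exact: mem_nth.
exists m, s; split => // A mA; rewrite -lawE//; congr (pushforward P _ A).
by apply/funext => w; rewrite /lin (big_nth (0, 0)) big_mkord.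
Qed.

Lemma lin1 t w : lin [:: (1, t)] w = W t w.
Proof. by rewrite /lin big_seq1 mul1r. Qed.

Lemma lin_sqr_integrable L : nneg_times L ->
  P.-integrable setT (fun w => (lin L w ^+ 2)%:E).
Proof.
move=> /lin_gaussian[m [s [s0 lawE]]].
exact: (gaussian_integrable_sqr (measurable_lin L) lawE).
Qed.

Lemma mul_integrable (X Y : T -> R) : measurable_fun setT X -> measurable_fun setT Y ->
  P.-integrable setT (fun w => (X w ^+ 2)%:E) ->
  P.-integrable setT (fun w => (Y w ^+ 2)%:E) ->
  P.-integrable setT (fun w => (X w * Y w)%:E).
Proof.
move=> mX mY iX iY; apply: (le_integrable _ _ _ (integrableD measurableT iX iY)) => //.
  by apply/measurable_EFinP; exact: measurable_funM.
move=> w _; rewrite /= lee_fin [leRHS]ger0_norm ?addr_ge0 ?sqr_ge0//.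
have h1 := sqr_ge0 (X w - Y w); have h2 := sqr_ge0 (X w + Y w).
have h3 := sqr_ge0 (X w); have h4 := sqr_ge0 (Y w).
rewrite ler_norml; apply/andP; split; nra.
Qed.

(** With Z = 1 this computes the mean of a functional; with Z the functional itself, then Z =
    [W q.2], its second moment. *)
Lemma Rintegral_linM L (Z : T -> R) :
  (forall t, 0 <= t -> P.-integrable setT (fun w => (W t w * Z w)%:E)) -> nneg_times L ->
  P.-integrable setT (fun w => (lin L w * Z w)%:E) /\
  \int[P]_w (lin L w * Z w) = \sum_(q <- L) q.1 * \int[P]_w (W q.2 w * Z w).
Proof.
move=> iZ; elim: L => [_|q L IH /= /andP[q0 L0]].
  rewrite big_nil; split.
    apply: (eq_integrable measurableT (fun=> 0%:E)) => [w _|].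
      by rewrite /lin big_nil mul0r.
    exact: finite_measure_integrable_cst.
  under eq_Rintegral do rewrite /lin big_nil mul0r.
  exact: Rintegral_cst_probability.
have [iL EL] := IH L0.
have iq := integrableZl measurableT q.1 (iZ _ q0).
have E w : lin (q :: L) w * Z w = q.1 * (W q.2 w * Z w) + lin L w * Z w.
  by rewrite /lin big_cons mulrDl mulrA.
split.
  apply: (eq_integrable measurableT _ _ _ (integrableD measurableT iq iL)) => w _.
  by rewrite E.
under eq_Rintegral do rewrite E.
rewrite RintegralD// RintegralZl ?big_cons ?EL//.
exact: iZ.
Qed.

Lemma fbm_sqr_integrable t : 0 <= t -> P.-integrable setT (fun w => (W t w ^+ 2)%:E).
Proof.
move=> t0; apply: (eq_integrable measurableT (fun w => (lin [:: (1, t)] w ^+ 2)%:E)).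
  by move=> w _; rewrite lin1.
by apply: lin_sqr_integrable; rewrite /= t0.
Qed.

Lemma lin_mean L : nneg_times L -> \int[P]_w lin L w = 0.
Proof.
move=> L0; have [_ _ meanW _ _] := fbmW.
have i1 t : 0 <= t -> P.-integrable setT (fun w => (W t w * 1)%:E).
  move=> t0; apply: mul_integrable => //; first exact: fbm_sqr_integrable.
  exact: finite_measure_integrable_cst.
have [_ E] := Rintegral_linM i1 L0.
under eq_Rintegral do rewrite -[lin L _]mulr1.
rewrite E big1_seq// => q /andP[_ qL].
have := meanW q.2 (allP L0 _ qL); rewrite unlock => mq.
by under eq_Rintegral do rewrite mulr1; rewrite /Rintegral mq mulr0.
Qed.

Lemma lin_second_moment L : nneg_times L -> \int[P]_w (lin L w ^+ 2) = lin_cov L L.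
Proof.
move=> L0; have [_ _ _ covW _] := fbmW.
have iWL t : 0 <= t -> P.-integrable setT (fun w => (W t w * lin L w)%:E).
  move=> t0; apply: mul_integrable => //.
  - exact: measurable_lin.
  - exact: fbm_sqr_integrable.
  - exact: lin_sqr_integrable.
have [_ E] := Rintegral_linM iWL L0.
under eq_Rintegral do rewrite expr2.
rewrite E; apply: eq_big_seq => q qL.
have q0 : 0 <= q.2 by exact: (allP L0 _ qL).
have iWW t : 0 <= t -> P.-integrable setT (fun w => (W t w * W q.2 w)%:E).
  by move=> t0; apply: mul_integrable => //; exact: fbm_sqr_integrable.
have [_ E'] := Rintegral_linM iWW L0.
under eq_Rintegral do rewrite mulrC.
rewrite E' mulr_sumr; apply: eq_big_seq => r rL.
rewrite mulrA; congr (_ * _).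
have := covW q.2 r.2 q0 (allP L0 _ rL); rewrite unlock => cqr.
under eq_Rintegral do rewrite mulrC.
by rewrite /Rintegral cqr.
Qed.

(** The process hypothesis yields some parameters m and s; the first two moments identify them. *)
Lemma lin_law L : nneg_times L -> 0 <= lin_cov L L /\
  forall A, measurable A ->
    pushforward P (lin L) A = gaussian_law 0 (Num.sqrt (lin_cov L L)) A.
Proof.
move=> L0; have [m [s [s0 lawE]]] := lin_gaussian L0.
have m0 : m = 0 by rewrite -(gaussian_mean (measurable_lin L) lawE) lin_mean.
have := gaussian_second_moment (measurable_lin L) s0 lawE m0.
rewrite lin_second_moment// => ->; split; first exact: sqr_ge0.
by move=> A mA; rewrite sqrtr_sqr ger0_norm// -m0 lawE.
Qed.

(** Concatenating scaled lists represents a linear combination of functionals as one functional, so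
    [lin_law] also governs finite families of them. *)
Lemma lin_cov_flatten (I : Type) (s : seq I) (F : I -> seq (R * R)) (a : I -> R) :
  let L := flatten [seq [seq (a i * q.1, q.2) | q <- F i] | i <- s] in
  lin_cov L L = \sum_(i <- s) \sum_(j <- s) a i * a j * lin_cov (F i) (F j).
Proof.
move=> L; rewrite /lin_cov /L big_flatten big_map; apply: eq_bigr => i _.
rewrite big_map; under eq_bigr do rewrite big_flatten big_map.
rewrite exchange_big; apply: eq_bigr => j _.
rewrite mulr_sumr; apply: eq_bigr => q _.
rewrite big_map mulr_sumr; apply: eq_bigr => r _ /=.
rewrite [RHS]mulrA; congr (_ * _); exact: mulrACA.
Qed.

Lemma lin_flatten (I : Type) (s : seq I) (F : I -> seq (R * R)) (a : I -> R) w :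
  lin (flatten [seq [seq (a i * q.1, q.2) | q <- F i] | i <- s]) w =
  \sum_(i <- s) a i * lin (F i) w.
Proof.
rewrite /lin big_flatten big_map; apply: eq_bigr => i _.
by rewrite big_map mulr_sumr; apply: eq_bigr => q _; rewrite mulrA.
Qed.

Lemma nneg_times_flatten (I : Type) (s : seq I) (F : I -> seq (R * R)) (a : I -> R) :
  (forall i, nneg_times (F i)) ->
  nneg_times (flatten [seq [seq (a i * q.1, q.2) | q <- F i] | i <- s]).
Proof.
move=> F0; elim: s => [//|i s IH] /=.
rewrite /nneg_times all_cat -/(nneg_times _) -/(nneg_times _) IH andbT.
by rewrite /nneg_times all_map; exact: F0.
Qed.

Definition config_lin (l : config) : seq (R * R) :=
  flatten [seq [:: (config_sign R p, right_pt R p); (- config_sign R p, left_pt R p)] | p <- l].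

Lemma config_linE (l : config) w : lin (config_lin l) w = config_sum (W ^~ w) l.
Proof.
rewrite /lin /config_lin big_flatten big_map; apply: eq_bigr => p _.
by rewrite !big_cons big_nil /= /config_sign; ring.
Qed.

Lemma config_lin_cov (l : config) :
  lin_cov (config_lin l) (config_lin l) = config_cov (2 * H) l.
Proof.
rewrite /lin_cov {1}/config_lin big_flatten big_map; apply: eq_bigr => p _.
rewrite !big_cons big_nil /= addr0 -big_split/=.
rewrite {1}/config_lin big_flatten big_map /config_cov1 mulr_sumr; apply: eq_bigr => r _.
rewrite !big_cons big_nil /= /inc_cov.
move: (cov _ _) (cov _ (left_pt R r)) => u1 u2.
move: (cov (left_pt R p) _) (cov (left_pt R p) (left_pt R r)) => u3 u4; ring.
Qed.

Lemma config_lin_nneg (S x : R) (l : config) : 0 <= x -> config_valid S x l ->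
  nneg_times (config_lin l).
Proof.
elim: l x => [//|p l IH] x x0 /= /and3P[h1 h2 h3].
have h4 : 0 <= left_pt R p by exact: le_trans h1.
have h5 : 0 <= right_pt R p by exact: le_trans (ltW h2).
by rewrite h4 h5; exact: IH h3.
Qed.

Section Family.
Variables (I : finType) (l : I -> config) (S : R).
Hypothesis vl : forall i, config_valid S 0 (l i).

Definition config_gram (i j : I) : R := lin_cov (config_lin (l i)) (config_lin (l j)).

Let flat (a : I -> R) :=
  flatten [seq [seq (a i * q.1, q.2) | q <- config_lin (l i)] | i <- index_enum I].

Let flat_nneg a : nneg_times (flat a).
Proof. by apply: nneg_times_flatten => i; exact: config_lin_nneg (lexx 0) (vl i). Qed.

Let flat_cov a : lin_cov (flat a) (flat a) = quad_form config_gram a.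
Proof. exact: lin_cov_flatten. Qed.

Lemma config_quad_ge0 a : 0 <= quad_form config_gram a.
Proof. by rewrite -flat_cov; have [] := lin_law (flat_nneg a). Qed.

Lemma config_family_law (a : I -> R) A : measurable A ->
  pushforward P (fun w => \sum_i a i * config_sum (W ^~ w) (l i)) A =
  gaussian_law 0 (Num.sqrt (quad_form config_gram a)) A.
Proof.
move=> mA; have [_ /(_ _ mA)] := lin_law (flat_nneg a).
rewrite flat_cov => <-; congr (pushforward P _ A); apply/funext => w.
by rewrite /flat lin_flatten; apply: eq_bigr => i _; rewrite config_linE.
Qed.

Lemma config_gram_diag i : config_gram i i = config_cov (2 * H) (l i).
Proof. exact: config_lin_cov. Qed.

End Family.
End GaussianFunctionals.

(** * Passage to the limit *)

Section NegligibleIntegral.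
Context (R : realType) d (T : measurableType d) (mu : {measure set T -> \bar R}).
Local Open Scope ereal_scope.
Import HBNNSimple.

(* [f] and [g] may be non-measurable, as the truncated variation of the paths may
   be: the library's integral of a nonnegative function is a supremum over the
   nonnegative simple functions below it. *)
Lemma le_integral_negligible (N : set T) (f g : T -> \bar R) :
  measurable N -> mu N = 0 -> (forall x, 0 <= f x) -> (forall x, 0 <= g x) ->
  (forall x, ~ N x -> f x <= g x) -> \int[mu]_x f x <= \int[mu]_x g x.
Proof.
move=> mN N0 f0 g0 fg; rewrite !ge0_integralTE//.
apply: ge_ereal_sup => _ [h /= hf <-].
have mNC : measurable (~` N) by exact: measurableC.
(* Setting the simple function to 0 on [N] keeps its integral and puts it below [g] everywhere. *)
apply: (@le_trans _ _ (sintegral mu (proj_nnsfun h mNC))); last first.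
  apply: ereal_sup_ubound; exists (proj_nnsfun h mNC) => //= x.
  rewrite /= mindicE; case: (boolP (x \in ~` N)) => [|_].
    by rewrite inE/= mulr1 => Nx; exact: le_trans (hf x) (fg _ Nx).
  by rewrite mulr0.
rewrite -!integralT_nnsfun le_eqVlt; apply/orP; left; apply/eqP.
apply: ae_eq_integral => //.
- exact/measurable_EFinP.
- exact/measurable_EFinP.
- exists N; split => // x /= H; apply: contrapT => Nx; apply: H => _.
  by rewrite /= mindicE mem_set// mulr1.
Qed.

Lemma eq_integral_negligible (N : set T) (f g : T -> \bar R) :
  measurable N -> mu N = 0 -> (forall x, 0 <= f x) -> (forall x, 0 <= g x) ->
  (forall x, ~ N x -> f x = g x) -> \int[mu]_x f x = \int[mu]_x g x.
Proof.
move=> mN N0 f0 g0 fg; apply/eqP; rewrite eq_le; apply/andP; split;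
by apply: (le_integral_negligible mN N0) => // x Nx; rewrite fg.
Qed.

End NegligibleIntegral.

(** * Concentration of a monotone limit *)

Section MonotoneConcentration.
Context (R : realType) d (T : measurableType d) (P : probability T R).
Variables (M : nat -> T -> R) (V : T -> \bar R) (k : R).
Hypotheses (mM : forall n, measurable_fun setT (M n))
  (iM : forall n, P.-integrable setT (EFin \o M n))
  (M0 : forall n w, 0 <= M n w)
  (ndM : forall w, {homo M ^~ w : n m / (n <= m)%N >-> n <= m})
  (k0 : 0 < k)
  (concM : forall n (u : R), 0 < u ->
    (P [set w | (u < `|M n w - \int[P]_x M n x|)%R] <= (2 * expR (- (k * u ^+ 2)))%:E)%E)
  (V0 : forall w, (0 <= V w)%E)
  (VM : {ae P, forall w, V w = ereal_sup (range (fun n => (M n w)%:E)) /\ (V w < +oo)%E}).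

Let m n := \int[P]_x M n x.
Let Mi w := ereal_sup (range (fun n => (M n w)%:E)).

Let cvg_Mi w : (M n w)%:E @[n --> \oo] --> Mi w.
Proof. by apply: ereal_nondecreasing_cvgn => a b ab; rewrite lee_fin; exact: ndM. Qed.

Let mMi : measurable_fun setT Mi.
Proof.
apply: (emeasurable_fun_cvg (fun n w => (M n w)%:E)) => [n|w _]; last exact: cvg_Mi.
exact/measurable_EFinP.
Qed.

Let Mi_ge0 w : (0 <= Mi w)%E.
Proof.
by apply: (@le_trans _ _ (M 0%N w)%:E); [rewrite lee_fin|apply: ereal_sup_ubound; exists 0%N].
Qed.

Let mE n : (\int[P]_w (M n w)%:E = (m n)%:E)%E.
Proof. by rewrite /m /Rintegral fineK//; exact: (integrable_fin_num measurableT (iM n)). Qed.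

Let cvg_m : (m n)%:E @[n --> \oo] --> (\int[P]_w Mi w)%E.
Proof.
rewrite (_ : (fun n => (m n)%:E) = fun n => (\int[P]_w (M n w)%:E)%E); last first.
  by apply/funext => n; rewrite mE.
have -> : (\int[P]_w Mi w = \int[P]_w (limn (fun n => (M n w)%:E)))%E.
  by apply: eq_integral => w _; apply/esym/cvg_lim => //; exact: cvg_Mi.
apply: cvg_monotone_convergence => //.
- by move=> n; exact/measurable_EFinP.
- by move=> n w _; rewrite lee_fin.
- by move=> w _ a b ab; rewrite lee_fin; exact: ndM.
Qed.

Let mlt n (u : R) : measurable [set w | (u < `|M n w - m n|)%R].
Proof.
rewrite (_ : [set w | _] = (fun w => `|M n w - m n|) @^-1` `]u, +oo[%classic).
  rewrite -[X in measurable X]setTI.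
  have : measurable_fun setT (fun w => `|M n w - m n|).
    by apply: measurableT_comp => //; exact: measurable_funB.
  by apply.
by apply/seteqP; split => w /=; rewrite in_itv/= andbT.
Qed.

Let mMi_gt (c : \bar R) : measurable [set w | (c < Mi w)%E].
Proof. by rewrite -[X in measurable X]setTI; exact: emeasurable_fun_o_infty. Qed.

(** The limit is almost surely finite, so the events Mi > K decrease to a null set. *)
Let Mi_tail : exists K : nat, (P [set w | (K%:R%:E < Mi w)%E] < (2^-1)%:E)%E.
Proof.
have [N [mN PN NP]] := VM.
pose B (j : nat) := [set w | (j%:R%:E < Mi w)%E].
have mB j : measurable (B j) by exact: mMi_gt.
have capB : P (\bigcap_j B j) = 0%E.
  apply/eqP; rewrite eq_le measure_ge0 andbT -PN le_measure ?inE//.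
    exact: bigcap_measurableType.
  move=> w Bw; apply: NP => /= -[Vw Voo].
  have Moo : Mi w = +oo%E.
    have := fun j => Bw j I; rewrite /B /=.
    case: (Mi w) => [r|//|] Br; last by have := Br 0%N.
    have := Br (Num.bound `|r|); rewrite lte_fin ltNge.
    by rewrite (le_trans (ler_norm r))// ltW// archi_boundP.
  by move: Voo; rewrite Vw -/(Mi w) Moo ltxx.
have cB : P (B j) @[j --> \oo] --> P (\bigcap_j B j).
  apply: nonincreasing_cvg_mu => //.
  - by rewrite (le_lt_trans (probability_le1 _ _))// ltry.
  - exact: bigcap_measurableType.
  - move=> a b ab; apply/subsetPset => w /=; apply: le_lt_trans.
    by rewrite lee_fin ler_nat.
apply: contrapT => nK; have : ((2^-1)%:E <= P (\bigcap_j B j))%E.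
  apply: (cvge_to_ge cB); apply: nearW => j; rewrite leNgt; apply/negP => Bj.
  by apply: nK; exists j.
by rewrite capB lee_fin leNgt invr_gt0 ltr0n.
Qed.

Let mean_bounded : (\int[P]_w Mi w < +oo)%E.
Proof.
have [K PK] := Mi_tail.
(* Makes the tail bound 2 exp(- 8), which is below 1/2 for every n. *)
pose u0 := Num.sqrt (8 / k).
have u02 : k * u0 ^+ 2 = 8.
  by rewrite sqr_sqrtr ?divr_ge0// ?(ltW k0)//; field; rewrite gt_eqF.
have u00 : 0 < u0 by rewrite sqrtr_gt0 divr_gt0.
have e8 : 2 * expR (- 8) < 2^-1 :> R.
  have h := expR_ge1Dx (8 : R); have h' := expR_gt0 (8 : R).
  rewrite expRN ltr_pdivrMr//; lra.
(* Were [m n] larger, concentration would put [M n] above [K] with probability more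
   than one half, against the choice of [K]. *)
have H n : m n <= K%:R + u0.
  rewrite leNgt; apply/negP => mn.
  have mS := mMi_gt K%:R%:E.
  have : (P setT <= P [set w | (K%:R%:E < Mi w)%E] + P [set w | (u0 < `|M n w - m n|)%R])%E.
    apply: le_trans (measureU2 _ mS (mlt n u0)).
    apply: le_measure; rewrite ?inE//; first exact: measurableU.
    move=> w _; have [h|h] := ltP (K%:R%:E) (Mi w); [by left|right].
    rewrite /= distrC; apply: (@lt_le_trans _ _ (m n - M n w)); last exact: ler_norm.
    have : M n w <= K%:R.
      by rewrite -lee_fin; apply: le_trans h; apply: ereal_sup_ubound; exists n.
    lra.
  rewrite probability_setT; apply/negP; rewrite -ltNge.
  have := concM n u00; rewrite u02 => h.
  apply: le_lt_trans (leeD (lexx _) h) _.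
  have -> : 1%E = ((2^-1)%:E + (2^-1)%:E :> \bar R)%E by rewrite -EFinD; congr EFin; lra.
  by apply: lteD => //; rewrite lte_fin.
apply: (@le_lt_trans _ _ (K%:R + u0)%:E); last exact: ltry.
by apply: (cvge_to_le cvg_m); apply: nearW => n; rewrite lee_fin.
Qed.

(** Off the null set, a limit that deviates by more than u forces [M n] to do so for all large n.
    The event therefore lies, up to [N], in the lower limit of the events [A n], an increasing union
    of measurable sets each contained in some [A j]. *)
Lemma monotone_concentration (u : R) : 0 < u ->
  (completed_prob P [set w | (u%:E < `|V w - \int[P]_x V x|)%E] <=
   (2 * expR (- (k * u ^+ 2)))%:E)%E.
Proof.
move=> u0; have [N [mN PN NP]] := VM.
have VN w : ~ N w -> V w = Mi w /\ (V w < +oo)%E.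
  by move=> Nw; apply: contrapT => h; apply: Nw; exact: NP.
have -> : (\int[P]_x V x = \int[P]_x Mi x)%E.
  by apply: (eq_integral_negligible mN PN) => // w /VN[].
have Ifin : (\int[P]_x Mi x)%E \is a fin_num.
  by rewrite ge0_fin_numE ?mean_bounded//; apply: integral_ge0.
rewrite -(fineK Ifin); set mm := fine _.
have cm : m n @[n --> \oo] --> mm.
  by have := cvg_m; rewrite -(fineK Ifin) => /fine_cvgP[].
pose A n := [set w | (u < `|M n w - m n|)%R].
pose D j := \bigcap_(n in [set n | (j <= n)%N]) A n.
have mD j : measurable (D j) by apply: bigcap_measurable => [|n _]; [exists j => /=|exact: mlt].
have mE' : measurable (\bigcup_j D j) by exact: bigcup_measurable.
have PE : (P (\bigcup_j D j) <= (2 * expR (- (k * u ^+ 2)))%:E)%E.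
  have cD : P (D j) @[j --> \oo] --> P (\bigcup_j D j).
    apply: nondecreasing_cvg_mu => // a b ab; apply/subsetPset => w Dw n /= bn.
    by apply: Dw; exact: leq_trans bn.
  apply: (cvge_to_le cD); apply: nearW => j.
  have mA : measurable (A j) := mlt j u.
  apply: (@le_trans _ _ (P (A j))); last exact: concM.
  by apply: le_measure; rewrite ?inE// => w Dw; exact: (Dw j (leqnn j)).
have sub : [set w | (u%:E < `|V w - mm%:E|)%E] `<=` N `|` \bigcup_j D j.
  move=> w /= uw; have [Nw|/VN[Vw Voo]] := pselect (N w); [by left|right].
  have Mfin : Mi w \is a fin_num by rewrite ge0_fin_numE// -Vw.
  move: uw; rewrite Vw -(fineK Mfin) -EFinB abse_EFin lte_fin => uw.
  have cw : M n w @[n --> \oo] --> fine (Mi w).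
    by have := cvg_Mi (w := w); rewrite -(fineK Mfin) => /fine_cvgP[].
  have cd : `|M n w - m n| @[n --> \oo] --> `|fine (Mi w) - mm|.
    by apply: cvg_norm; apply: cvgB.
  have [j _ jP] := cvgr_gt _ cd _ uw.
  by exists j => // n /= jn; exact: jP.
apply: (le_trans (le_mu_ext P sub)).
rewrite (measurable_mu_extE P); last exact: measurableU.
apply: (le_trans (measureU2 _ mN mE')).
by rewrite [X in (X + _)%E]PN add0e.
Qed.

End MonotoneConcentration.

Section TruncatedVariationConcentration.
Context (R : realType) d (T : measurableType d) (P : probability T R).
Context (H : R) (W : R -> {RV P >-> R}) (S c : R).
Hypotheses (H2 : 1 <= 2 * H) (fbmW : fractional_brownian_motion P H W)
  (S0 : 0 < S) (c0 : 0 < c).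

Let M n w := max_affine (ord0 : 'I_n.+1)
  (fun i => c * (size (config_enum S i))%:R)
  (fun i => config_sum (W ^~ w) (config_enum S i)).

Let val_le_M n i w : (i <= n)%N -> config_val c (W ^~ w) (config_enum S i) <= M n w.
Proof.
move=> ni; have := @max_affine_ge R 'I_n.+1 ord0
  (fun i => c * (size (config_enum S i))%:R)
  (fun i => config_sum (W ^~ w) (config_enum S i)) (Ordinal (n:=n.+1) (m:=i) ni).
exact.
Qed.

Let M_val n w : exists2 i, (i <= n)%N & M n w = config_val c (W ^~ w) (config_enum S i).
Proof.
have [i Mi] := @max_affine_attained R 'I_n.+1 ord0
  (fun i => c * (size (config_enum S i))%:R)
  (fun i => config_sum (W ^~ w) (config_enum S i)).
by exists i => //; rewrite -ltnS.
Qed.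

Let M_ge0 n w : 0 <= M n w.
Proof.
have := val_le_M w (leq0n n).
by rewrite config_enum0 /config_val /config_sum big_nil mulr0 subr0.
Qed.

Let ndM w : {homo M ^~ w : n m / (n <= m)%N >-> n <= m}.
Proof.
move=> n m nm; have [i ni ->] := M_val n w.
by apply: val_le_M; exact: leq_trans nm.
Qed.

Let sup_M w : ereal_sup (range (fun n => (M n w)%:E)) =
  ereal_sup (range (fun n => (config_val c (W ^~ w) (config_enum S n))%:E)).
Proof.
apply/eqP; rewrite eq_le; apply/andP; split; apply: ge_ereal_sup => _ [n _ <-].
  by have [i _ ->] := M_val n w; apply: ereal_sup_ubound; exists i.
apply: (@le_trans _ _ (M n w)%:E); first by rewrite lee_fin val_le_M.
by apply: ereal_sup_ubound; exists n.
Qed.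

Let msum (l : config) : measurable_fun setT (fun w => config_sum (W ^~ w) l).
Proof.
rewrite (_ : (fun w => _) = lin W (config_lin R l)); first exact: measurable_lin.
by apply/funext => w; rewrite config_linE.
Qed.

Let H0 : 0 <= 2 * H. Proof. exact: le_trans H2. Qed.

Lemma TV_concentration (u : R) : 0 < u ->
  (completed_prob P
     [set w | u%:E < `|TV c (W ^~ w) S - \int[P]_w' TV c (W ^~ w') S|]
   <= (2 * expR (- (2 / pi ^+ 2 * S `^ (- (2 * H)) * u ^+ 2)))%:E)%E.
Proof.
move=> u0.
have vl n (i : 'I_n.+1) : config_valid S 0 (config_enum S i).
  by apply: config_enum_valid; exact: ltW.
have gramv n (i : 'I_n.+1) :
    config_gram H (fun i : 'I_n.+1 => config_enum S i) i i <= S `^ (2 * H).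
  rewrite config_gram_diag; apply: le_trans (config_cov_bound H2 (vl n i)) _.
  rewrite inc_cov_diag//; last by rewrite gt_eqF// (lt_le_trans ltr01).
  by rewrite subr0 gtr0_norm.
have k0 : 0 < 2 / pi ^+ 2 * S `^ (- (2 * H)) :> R.
  by rewrite mulr_gt0 ?powR_gt0// divr_gt0// exprn_gt0// pi_gt0.
apply: (@monotone_concentration R d T P M (fun w => TV c (W ^~ w) S)) => //.
- by move=> n; apply: measurable_max_affine => i; exact: msum.
- move=> n; apply: integrable_max => [i|a A mA]; first exact: msum.
  exact: (config_family_law fbmW (@vl n)).
- move=> n {}u {}u0.
  have := @max_affine_concentration R d T P _
    (fun (i : 'I_n.+1) w => config_sum (W ^~ w) (config_enum S i)) _ ord0
    (fun i => c * (size (config_enum S i))%:R) (S `^ (2 * H))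
    (fun i => msum _) (config_quad_ge0 fbmW (@vl n)) (config_family_law fbmW (@vl n))
    (@gramv n) u (powR_gt0 _ S0) u0.
  rewrite powRN (_ : 2 / pi ^+ 2 * _ * _ = 2 / pi ^+ 2 * (u ^+ 2 / S `^ (2 * H))) //.
  by rewrite -mulrA [_^-1 * _]mulrC.
- by move=> w; have := config_val_le_TV (W ^~ w) (l := [::]) (ltW c0) S0 (ltW S0);
    rewrite /config_val /config_sum big_nil mulr0 subr0.
- have [_ _ _ _ contW] := fbmW; apply: filterS contW => w cw.
  by split; [rewrite sup_M; apply: TV_config_sup => //; exact: ltW|exact: TV_lty].
Qed.

End TruncatedVariationConcentration.

(** Both sides carry S^(2 - 2 H) c^(2 - 2 / H), which makes the two forms of the tail bound the same
    under u = S c^(1 - 1/H) v. *)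
Lemma concentration_rescale (R : realType) (B H S c v : R) : 0 < H -> 0 < S -> 0 < c ->
  B * S `^ (- (2 * H)) * (S * c `^ (1 - 1 / H) * v) ^+ 2 =
  B * (S * c `^ (- (1 / H))) `^ (2 - 2 * H) * v ^+ 2.
Proof.
move=> H0 S0 c0; rewrite [(_ * v) ^+ 2]exprMn mulrA; congr (_ * _).
rewrite -[LHS]mulrA; congr (_ * _).
rewrite -powR_mulrn ?mulr_ge0 ?powR_ge0 ?ltW// !powRM ?powR_ge0 ?ltW// mulrA.
rewrite -!powRrM -powRD; last by rewrite (gt_eqF S0) implybT.
by congr (_ `^ _ * _ `^ _); field; rewrite ?gt_eqF.
Qed.

Theorem theorem2p3 (R : realType) :
  exists A B : R,
    [/\ 0 < A, A <= 4, 0 < B & 2 / pi ^+ 2 <= B] /\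
    forall (d : measure_display) (T : measurableType d) (P : probability T R)
      (H : R) (W : R -> {RV P >-> R}) (S c : R),
      1 / 2 <= H -> H < 1 ->
      fractional_brownian_motion P H W ->
      0 < S -> 0 < c -> c <= S `^ H ->
      (forall u : R, 0 < u ->
        (completed_prob P
           [set w | u%:E < `|TV c (W ^~ w) S - \int[P]_w' TV c (W ^~ w') S|]
         <= (A * expR (- (B * S `^ (- (2 * H)) * u ^+ 2)))%:E)%E) /\
      (forall v : R, 0 < v ->
        (completed_prob P
           [set w | (S * c `^ (1 - 1 / H) * v)%:E <
                    `|TV c (W ^~ w) S - \int[P]_w' TV c (W ^~ w') S|]
         <= (A * expR (- (B * (S * c `^ (- (1 / H))) `^ (2 - 2 * H)
                          * v ^+ 2)))%:E)%E).
Proof.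
have B0 : 0 < 2 / pi ^+ 2 :> R by rewrite divr_gt0// exprn_gt0// pi_gt0.
exists 2, (2 / pi ^+ 2); split; first by split => //; rewrite ler_nat.
move=> d T P H W S c H2 _ fbmW S0 c0 _.
have [/andP[H0 _] _ _ _ _] := fbmW.
have H2' : 1 <= 2 * H by rewrite mulrC -ler_pdivrMr.
split=> [u u0|v v0]; first exact: TV_concentration.
by rewrite -concentration_rescale//; apply: TV_concentration; rewrite ?mulr_gt0 ?powR_gt0.
Qed.
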